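(* Let $(\mathcal{S},G,\mathfrak{g},\alpha)$ and $(\mathcal{T},G,\mathfrak{g},\beta)$ be operator system dynamical systems and let $\phi:\mathcal{S}\to\mathcal{T}$ be a $G$-equivariant unital completely positive (ucp) map. Then the map $$\widetilde{\phi}:\mathcal{S}\rtimes_{\alpha,\lambda}\mathfrak{g}\to\mathcal{T}\rtimes_{\beta,\lambda}\mathfrak{g},\qquad a\lambda_g\mapsto\phi(a)\lambda_g$$ is ucp. If $\phi$ is a complete order embedding, then $\widetilde{\phi}$ is also a complete order embedding.
   Context: An (operator system) dynamical system $(\mathcal{S},G,\mathfrak{g},\alpha)$ consists of an operator system $\mathcal{S}$, a discrete group $G$, a generating set $\mathfrak{g}$ of $G$ with $\mathfrak{g}^{-1}=\mathfrak{g}$ and $e\in\mathfrak{g}$, and a group homomorphism $\alpha:G\to\mathrm{Aut}(\mathcal{S})$ into the group of unital complete order isomorphisms of $\mathcal{S}$. A ucp map $\phi:\mathcal{S}\to\mathcal{T}$ is $G$-equivariant if $\beta_g(\phi(s))=\phi(\alpha_g(s))$ for all $g\in G$, $s\in\mathcal{S}$. $C^*_{\mathrm{env}}(\mathcal{S})$ is the $C^*$-envelope of $\mathcal{S}$; the action $\alpha$ extends uniquely to an action of $G$ on it by $*$-automorphisms, again denoted $\alpha$. The reduced crossed product is the operator subsystem $\mathcal{S}\rtimes_{\alpha,\lambda}\mathfrak{g}:=\mathrm{span}\{a\lambda_g:a\in\mathcal{S},g\in\mathfrak{g}\}$ of the reduced $C^*$-crossed product $C^*_{\mathrm{env}}(\mathcal{S})\rtimes_{\alpha,\lambda}G$,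 where $\lambda_g$ are the canonical unitaries. *)

(* Defs.v *)
From HB Require Import structures.
From mathcomp Require Import all_boot all_order all_algebra.
From mathcomp Require Import complex.
From mathcomp Require Import all_classical all_reals.
From mathcomp Require Import ereal esum numfun topology normedtype sequences.
From mathcomp Require Import ring lra.

Set Implicit Arguments.
Unset Strict Implicit.
Unset Printing Implicit Defensive.

Import Order.TTheory GRing.Theory Num.Theory.
Import numFieldNormedType.Exports.

Local Open Scope classical_set_scope.
Local Open Scope ring_scope.
Local Open Scope complex_scope.

Section MatrixOrder.
Variable R : realType.
Implicit Types V W : lmodType R[i].

(* B^* X B for a scalar matrix B. *)
Definition mx_compress V m n (B : 'M[R[i]]_(m, n)) (X : 'M[V]_m) : 'M[V]_n :=
  \matrix_(i, j) \sum_k \sum_l (Num.conj (B k i) * B l j) *: X k l.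

Definition diag_const V (e : V) n : 'M[V]_n := \matrix_(i, j) (e *+ (i == j)).

Definition mx_cones V := forall n, set 'M[V]_n.

Definition completely_positive V W (P : mx_cones V) (Q : mx_cones W)
    (f : V -> W) :=
  forall n (X : 'M[V]_n), P n X -> Q n (map_mx f X).

Definition ucp V W (eV : V) (P : mx_cones V) (eW : W) (Q : mx_cones W)
    (f : V -> W) :=
  f eV = eW /\ completely_positive P Q f.

(* A complete order isomorphism onto its range. *)
Definition complete_order_embedding V W (P : mx_cones V) (Q : mx_cones W)
    (f : V -> W) :=
  injective f /\ forall n (X : 'M[V]_n), P n X <-> Q n (map_mx f X).

End MatrixOrder.

(* Operator systems in the sense of Choi and Effros: matrix ordered *-vector
   spaces with an Archimedean matrix order unit. Compression by scalar matrices
   subsumes stability of the cones under multiplication by nonnegative reals;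
   as usual, the zero space is excluded. *)
HB.mixin Record isOperatorSystem (R : realType) V of GRing.Lmodule R[i] V := {
  os_star : V -> V;
  os_unit : V;
  os_pos : forall n, set 'M[V]_n;
  os_starK : involutive os_star;
  os_starD : {morph os_star : x y / x + y};
  os_starZ : forall (c : R[i]) x, os_star (c *: x) = Num.conj c *: os_star x;
  os_unit_neq0 : os_unit != 0;
  os_star_unit : os_star os_unit = os_unit;
  os_pos_herm : forall n (X : 'M[V]_n),
    os_pos n X -> forall i j, os_star (X i j) = X j i;
  os_posD : forall n (X Y : 'M[V]_n),
    os_pos n X -> os_pos n Y -> os_pos n (X + Y);
  os_pos_compress : forall m n (B : 'M[R[i]]_(m, n)) (X : 'M[V]_m),
    os_pos m X -> os_pos n (mx_compress B X);
  os_pos_proper : forall n (X : 'M[V]_n),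
    os_pos n X -> os_pos n (- X) -> X = 0;
  os_order_unit : forall n (X : 'M[V]_n),
    (forall i j, os_star (X i j) = X j i) ->
    exists2 r : R, 0 < r & os_pos n (diag_const (r%:C *: os_unit) n + X);
  os_archimedean : forall n (X : 'M[V]_n),
    (forall r : R, 0 < r -> os_pos n (diag_const (r%:C *: os_unit) n + X)) ->
    os_pos n X
}.

#[short(type="operatorSystemType")]
HB.structure Definition OperatorSystem (R : realType) :=
  {V of isOperatorSystem R V & GRing.Lmodule R[i] V}.

Arguments os_unit {R} s.
Arguments os_pos {R} s n.

Definition os_ucp (R : realType) (S T : operatorSystemType R) (f : S -> T) :=
  ucp (os_unit S) (os_pos S) (os_unit T) (os_pos T) f.

(* Unital C*-algebras. The norm does not come from the normed modules of the
   library: in its hierarchy, the only join of these with rings is a numeric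
   domain. The algebra is nonzero because the library's algebras are. *)
HB.mixin Record isCStar (R : realType) A of GRing.Algebra R[i] A := {
  star : A -> A;
  cnorm : A -> R;
  starK : involutive star;
  starD : {morph star : x y / x + y};
  starZ : forall (c : R[i]) x, star (c *: x) = Num.conj c *: star x;
  starM : forall x y, star (x * y) = star y * star x;
  cnorm_eq0 : forall x, cnorm x = 0 -> x = 0;
  cnormD : forall x y, cnorm (x + y) <= cnorm x + cnorm y;
  cnormZ : forall (c : R[i]) x, cnorm (c *: x) = complex.Re `|c| * cnorm x;
  cnormM : forall x y, cnorm (x * y) <= cnorm x * cnorm y;
  cnorm_starM : forall x, cnorm (star x * x) = cnorm x ^+ 2;
  cnorm_complete : forall u : nat -> A,
    (forall e : R, 0 < e -> exists N, forall m n,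
       (N <= m)%N -> (N <= n)%N -> cnorm (u m - u n) < e) ->
    exists l, forall e : R, 0 < e -> exists N, forall n,
       (N <= n)%N -> cnorm (u n - l) < e
}.

#[short(type="cstarType")]
HB.structure Definition CStar (R : realType) :=
  {A of isCStar R A & GRing.Algebra R[i] A}.

Section CStarDefs.
Variable R : realType.
Implicit Types A B : cstarType R.

(* The positive elements Y^* Y of the C*-algebra M_n(A). *)
Definition cstar_pos A : mx_cones A := fun n =>
  [set X | exists Y : 'M[A]_n,
     X = \matrix_(i, j) \sum_k star (Y k i) * Y k j].

Record star_subalgebra A (D : set A) : Prop := StarSubalgebra {
  ssa_one : D 1;
  ssa_lin : forall (c : R[i]) x y, D x -> D y -> D (c *: x + y);
  ssa_mul : forall x y, D x -> D y -> D (x * y);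
  ssa_star : forall x, D x -> D (star x)
}.

Definition cnorm_closed A (D : set A) :=
  forall x, (forall e : R, 0 < e -> exists2 y, D y & cnorm (x - y) < e) -> D x.

Definition cstar_generates A (X : set A) :=
  forall D : set A, star_subalgebra D -> cnorm_closed D -> X `<=` D -> D = setT.

(* Unital complete order embeddings of S whose range generates A. *)
Record cstar_cover (S : operatorSystemType R) A (j : {linear S -> A}) : Prop :=
  CStarCover {
  cover_unital : j (os_unit S) = 1;
  cover_coe : complete_order_embedding (os_pos S) (@cstar_pos A) j;
  cover_gen : cstar_generates (range j)
}.

Record cstar_envelope (S : operatorSystemType R) := CStarEnvelope {
  env_alg : cstarType R;
  env_emb : {linear S -> env_alg};
  env_cover : cstar_cover env_emb;
  env_univ : forall B (j : {linear S -> B}), cstar_cover j ->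
    exists p : {lrmorphism B -> env_alg},
      [/\ {morph p : x / star x >-> star x}, set_surj setT setT p &
          forall s, p (j s) = env_emb s]
}.

End CStarDefs.

(* The library's {dot _ for _} is linear in its first argument. *)
HB.mixin Record isHilbert (R : realType) H of CompleteNormedModule R[i] H := {
  hdot : {dot H for Num.conj};
  hdot_norm : forall v : H, hdot v v = `|v| ^+ 2
}.

#[short(type="hilbertType")]
HB.structure Definition Hilbert (R : realType) :=
  {H of isHilbert R H & CompleteNormedModule R[i] H}.

Record faithful_representation (R : realType) (A : cstarType R) :=
  FaithfulRepresentation {
  rep_space : hilbertType R;
  rep_map :> A -> {linear rep_space -> rep_space};
  rep_bounded : forall a, exists M : R, forall v,
    `|rep_map a v| <= M%:C * `|v|;
  rep_linear : forall (c : R[i]) a b v,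
    rep_map (c *: a + b) v = c *: rep_map a v + rep_map b v;
  rep_one : forall v, rep_map 1 v = v;
  rep_mul : forall a b v, rep_map (a * b) v = rep_map a (rep_map b v);
  rep_star : forall a v w, hdot (rep_map a v) w = hdot v (rep_map (star a) w);
  rep_faithful : forall a, (forall v, rep_map a v = 0) -> a = 0
}.
Arguments rep_space {R A}.

Record symmetric_generating_set (G : groupType) (gens : set G) : Prop :=
  SymmetricGeneratingSet {
  gens_one : gens 1%g;
  gens_inv : forall g, gens g -> gens g^-1%g;
  gens_gen : forall K : set G, gens `<=` K -> K 1%g ->
    (forall g h, K g -> K h -> K (g * h)%g) ->
    (forall g, K g -> K g^-1%g) -> K = setT
}.

(* A homomorphism from G to the group of unital complete order isomorphisms. *)
Record os_action (R : realType) (G : groupType) (S : operatorSystemType R) :=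
  OsAction {
  os_act :> G -> {linear S -> S};
  os_act1 : forall s, os_act 1%g s = s;
  os_actM : forall g h s, os_act (g * h)%g s = os_act g (os_act h s);
  os_act_bij : forall g, bijective (os_act g);
  os_act_unit : forall g, os_act g (os_unit S) = os_unit S;
  os_act_coe : forall g,
    complete_order_embedding (os_pos S) (os_pos S) (os_act g)
}.

Record cstar_action (R : realType) (G : groupType) (A : cstarType R) :=
  CStarAction {
  cs_act :> G -> {lrmorphism A -> A};
  cs_act_star : forall g, {morph cs_act g : a / star a >-> star a};
  cs_act1 : forall a, cs_act 1%g a = a;
  cs_actM : forall g h a, cs_act (g * h)%g a = cs_act g (cs_act h a)
}.

(* The (unique) extension of an action on S to the C*-envelope of S. *)
Record extended_action (R : realType) (G : groupType)
    (S : operatorSystemType R) (alpha : os_action G S) (E : cstar_envelope S) :=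
  ExtendedAction {
  ext_act :> cstar_action G (env_alg E);
  ext_actE : forall g s, ext_act g (env_emb E s) = env_emb E (alpha g s)
}.

Section Span.
Variables (K : comNzRingType) (V : lmodType K).

Definition lspan (X : set V) : set V :=
  [set v | exists n (c : 'I_n -> K) (x : 'I_n -> V),
     (forall i, X (x i)) /\ v = \sum_i c i *: x i].

Definition in_lspan (X : set V) : {pred V} := mem (lspan X).

Lemma lspan_submod (X : set V) : submod_closed (in_lspan X).
Proof.
split; first by apply/mem_set; exists 0%N, (fun=> 0), (fun=> 0);
  split=> [[]//|]; rewrite big_ord0.
move=> c u v /set_mem[m [a [x [Xx ->]]]] /set_mem[n [b [y [Yy ->]]]].
apply/mem_set; exists (m + n)%N.
exists (fun k : 'I_(m + n) =>
  match fintype.split k with inl i => c * a i | inr j => b j end).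
exists (fun k : 'I_(m + n) =>
  match fintype.split k with inl i => x i | inr j => y j end).
split=> [k|]; first by case: (fintype.split k).
rewrite big_split_ord /= scaler_sumr; congr (_ + _); apply: eq_bigr => i _.
  by rewrite (unsplitK (inl i)) scalerA.
by rewrite (unsplitK (inr i)).
Qed.

Lemma lspan_gen (X : set V) x : X x -> x \in in_lspan X.
Proof.
move=> Xx; apply/mem_set; exists 1%N, (fun=> 1), (fun=> x); split=> //.
by rewrite big_ord1 scale1r.
Qed.

Record span_type (X : set V) :=
  SpanType { span_val :> V; span_valP : span_val \in in_lspan X }.

HB.instance Definition _ X := [isSub for @span_val X].
HB.instance Definition _ X := [Choice of span_type X by <:].
HB.instance Definition _ X :=
  GRing.isSubmodClosed.Build K V (in_lspan X) (lspan_submod X).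
HB.instance Definition _ X := [SubChoice_isSubLmodule of span_type X by <:].

Definition span_gen (X : set V) x (Xx : X x) : span_type X :=
  SpanType (lspan_gen Xx).

End Span.

(* *-representations are contractive; this makes the regular representation
   below well defined. *)

Section Contractive.
Variables (R : realType) (A : cstarType R).
Implicit Types (x y z : A).

Lemma cnorm0 : cnorm (0 : A) = 0.
Proof. by rewrite -(scale0r 0) cnormZ normr0 mul0r. Qed.

Lemma cnormN x : cnorm (- x) = cnorm x.
Proof. by rewrite -scaleN1r cnormZ normrN1 mul1r. Qed.

Lemma cnorm_ge0 x : 0 <= cnorm x.
Proof. by have := cnormD x (- x); rewrite subrr cnorm0 cnormN; lra. Qed.

Lemma cnormB x y : cnorm (x - y) = cnorm (y - x).
Proof. by rewrite -cnormN opprB. Qed.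

Lemma star0 : star (0 : A) = 0.
Proof. by rewrite -(scale0r 0) starZ conjC0 !scale0r. Qed.

Lemma starN x : star (- x) = - star x.
Proof. by apply/eqP; rewrite -addr_eq0 -starD addNr star0. Qed.

Lemma star1 : star (1 : A) = 1.
Proof. by rewrite -[LHS]mul1r -{1}(starK 1) -starM mul1r starK. Qed.

Lemma cnorm_star x : cnorm (star x) = cnorm x.
Proof.
suff le y : cnorm y <= cnorm (star y).
  by apply/le_anti; rewrite le andbT -{2}(starK x) le.
have [y0|y0] := eqVneq (cnorm y) 0; first by rewrite y0 cnorm_ge0.
have y_gt0 : 0 < cnorm y by rewrite lt_neqAle eq_sym y0 cnorm_ge0.
by rewrite -(ler_pM2r y_gt0) -expr2 -cnorm_starM cnormM.
Qed.

Lemma Re_half : complex.Re `|2^-1 : R[i]| = 2^-1.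
Proof.
rewrite ger0_norm ?invr_ge0//.
by rewrite (_ : 2^-1 = (2^-1 : R)%:C) //= rmorphV ?unitfE//= rmorph_nat.
Qed.

(* The square root 1 - y of 1 - x, where y solves y = (x + y^2) / 2. *)
Lemma cstar_sqrt x : star x = x -> cnorm x < 1 ->
  exists2 c, star c = c & c * c = 1 - x.
Proof.
move=> xJ x1; set r := cnorm x.
have r0 : 0 <= r by exact: cnorm_ge0.
pose F y := (2^-1 : R[i]) *: (x + y * y).
have FJ y : star y = y -> star (F y) = F y.
  move=> yJ; rewrite /F starZ starD starM yJ xJ; congr (_ *: _).
  by rewrite fmorphV rmorph_nat.
have Fr y : cnorm y <= r -> cnorm (F y) <= r.
  move=> yr; rewrite cnormZ Re_half.
  have := cnormD x (y * y); have := cnormM y y.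
  have := ler_pM (cnorm_ge0 y) (cnorm_ge0 y) yr yr.
  have : r * r <= r by rewrite ler_piMl// ltW.
  rewrite -/r; lra.
have FL y z : cnorm y <= r -> cnorm z <= r ->
    cnorm (F y - F z) <= r * cnorm (y - z).
  move=> yr zr; rewrite /F -scalerBr opprD addrACA subrr add0r.
  rewrite (_ : y * y - z * z = y * (y - z) + (y - z) * z); last first.
    by rewrite mulrBr mulrBl addrA subrK.
  rewrite cnormZ Re_half.
  have := cnormD (y * (y - z)) ((y - z) * z).
  have := cnormM y (y - z); have := cnormM (y - z) z.
  have := ler_wpM2r (cnorm_ge0 (y - z)) yr.
  have := ler_wpM2r (cnorm_ge0 (y - z)) zr.
  rewrite (mulrC (cnorm (y - z)) (cnorm z)); lra.
pose u n := iter n F 0.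
have ur n : cnorm (u n) <= r.
  by elim: n => [|n]; [rewrite cnorm0 | exact: Fr].
have uJ n : star (u n) = u n by elim: n => [|n IH]; [exact: star0|exact: FJ].
have uL n m : cnorm (u (n + m)%N - u n) <= r ^+ n.
  elim: n => [|n IH]; first by rewrite /= subr0 (le_trans (ur _)) ?ltW.
  by rewrite (le_trans (FL _ _ (ur _) (ur _)))// exprS ler_wpM2l.
have [p pl] : exists l, forall e : R, 0 < e -> exists N, forall n,
    (N <= n)%N -> cnorm (u n - l) < e.
  apply: cnorm_complete => e e0.
  have e20 : 0 < e / 2 by rewrite divr_gt0.
  have : `|r| < 1 by rewrite ger0_norm.
  move=> /cvg_expr /cvgrPdist_lt /(_ _ e20) [N _ /(_ N (leqnn N))].
  rewrite /= sub0r normrN ger0_norm ?exprn_ge0// => rN.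
  exists N => m n Nm Nn.
  have := uL N (m - N)%N; have := uL N (n - N)%N; rewrite !subnKC// => h1 h2.
  have := cnormD (u m - u N) (u N - u n).
  rewrite addrA subrK (cnormB (u N)); lra.
have small_eq y z : (forall e : R, 0 < e -> cnorm (y - z) < e) -> y = z.
  move=> h; apply/eqP; rewrite -subr_eq0; apply/eqP/cnorm_eq0/eqP.
  rewrite eq_le cnorm_ge0 andbT leNgt; apply/negP => /h.
  by rewrite ltxx.
have pJ : star p = p.
  apply: small_eq => e e0.
  have [|N /(_ N (leqnn N)) h] := pl (e / 2); first by rewrite divr_gt0.
  have hJ : cnorm (star p - u N) = cnorm (u N - p).
    by rewrite -{1}(uJ N) -starN -starD cnorm_star cnormB.
  have := cnormD (star p - u N) (u N - p).
  rewrite addrA subrK; lra.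
have pr : cnorm p <= r.
  rewrite leNgt; apply/negP => rp.
  have [|N /(_ N (leqnn N)) h] := pl (cnorm p - r); first by rewrite subr_gt0.
  have := cnormD (p - u N) (u N); have := ur N.
  rewrite subrK cnormB; lra.
have Fp : F p = p.
  apply: small_eq => e e0.
  have [|N h] := pl (e / 2); first by rewrite divr_gt0.
  have := h N (leqnn N); have := h N.+1 (leqnSn N).
  have := FL _ _ pr (ur N).
  have := ler_piMl (cnorm_ge0 (p - u N)) (ltW x1).
  have := cnormD (F p - F (u N)) (F (u N) - p).
  rewrite addrA subrK (cnormB p (u N)) /= -/r; lra.
exists (1 - p); first by rewrite starD starN star1 pJ.
have p2 : p + p = x + p * p.
  by rewrite -mulr2n -{1}Fp /F -scaler_nat scalerA divff// scale1r.
by rewrite mulrBl mul1r mulrBr mulr1 -addrA -opprD addrA p2 addrK.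
Qed.

Lemma rep_contractive (H : hilbertType R) (q : A -> H -> H)
    (q_lin : forall (c : R[i]) a b v, q (c *: a + b) v = c *: q a v + q b v)
    (q1 : forall v, q 1 v = v) (qM : forall a b v, q (a * b) v = q a (q b v))
    (qJ : forall a v w, hdot (q a v) w = hdot v (q (star a) w))
    a v (t : R) : cnorm a < t -> `|q a v| <= t%:C * `|v|.
Proof.
move=> at_; have t0 : 0 < t by apply: le_lt_trans at_; exact: cnorm_ge0.
have tC0 : t%:C != 0 :> R[i] by rewrite gt_eqF// ltcR.
pose b : A := (t%:C)^-1 *: a.
have absV : `|(t%:C)^-1 : R[i]| = (t^-1)%:C.
  by rewrite ger0_norm ?invr_ge0 ?lecR ?ltW// fmorphV.
have b1 : cnorm (star b * b) < 1.
  rewrite cnorm_starM expr_lt1// ?cnorm_ge0// cnormZ absV /=.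
  by rewrite mulrC ltr_pdivrMr// mul1r.
have bJ : star (star b * b) = star b * b by rewrite starM starK.
have [c cJ cc] := cstar_sqrt bJ b1.
have qbv : q b v = (t%:C)^-1 *: q a v.
  have q0 w : q 0 w = 0.
    by have := q_lin 1 0 0 w; rewrite scale1r addr0 scale1r => /eqP;
      rewrite -subr_eq0 opprD addrA subrr sub0r oppr_eq0 => /eqP.
  by have := q_lin (t%:C)^-1 a 0 v; rewrite addr0 q0 addr0.
have split_norm : `|v| ^+ 2 = `|q b v| ^+ 2 + `|q c v| ^+ 2.
  rewrite -!hdot_norm !qJ -!qM cJ cc -linearDr.
  by rewrite -[in RHS](scale1r (q _ v)) -q_lin scale1r addrC subrK q1.
have : `|q b v| ^+ 2 <= `|v| ^+ 2 by rewrite split_norm lerDl exprn_ge0.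
rewrite ler_sqr ?nnegrE// qbv normrZ absV fmorphV mulrC ler_pdivrMr ?ltcR//.
by rewrite mulrC.
Qed.

End Contractive.

(* The Hilbert space l^2(G, H) of square summable functions G -> H. *)

Section L2.
Variables (R : realType) (G : groupType) (H : hilbertType R).

Definition hnorm (v : H) : R := complex.Re `|v|.

Lemma hnormE v : (hnorm v)%:C = `|v|.
Proof. by apply: RRe_real; rewrite ger0_real. Qed.

Lemma hnorm_ge0 v : 0 <= hnorm v.
Proof. by rewrite -ler0c hnormE. Qed.

Definition sq_sum (f : G -> H) : \bar R :=
  (\esum_(g in [set: G]) (hnorm (f g) ^+ 2)%:E)%E.

Lemma esum_dom (a b : G -> R) (k : R) : 0 <= k -> (forall g, 0 <= b g) ->
  (forall g, a g <= k * b g) -> (\esum_(g in [set: G]) (b g)%:E < +oo)%E ->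
  (\esum_(g in [set: G]) (a g)%:E < +oo)%E.
Proof.
move=> k0 b0 ab boo.
apply: (@le_lt_trans _ _ (k%:E * \esum_(g in [set: G]) (b g)%:E)%E).
  apply: ge_ereal_sup => _ [F [finF _] <-].
  apply: (@le_trans _ _ (\sum_(g \in F) k%:E * (b g)%:E)%E).
    by apply: lee_fsum => // g _; rewrite -EFinM lee_fin.
  rewrite -ge0_mule_fsumr; last by move=> g; rewrite lee_fin.
  by apply: lee_wpmul2l; rewrite ?lee_fin//; apply: esum_ge; exists F.
by rewrite lte_mul_pinfty// esum_ge0// => g _; rewrite lee_fin.
Qed.

Definition in_l2 : {pred (G -> H)} := mem [set f | (sq_sum f < +oo)%E].

Lemma sq_sum0 : sq_sum 0 = 0%E.
Proof.
by rewrite /sq_sum esum1// => g _; rewrite /hnorm /= normr0 /= expr0n.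
Qed.

Lemma l2_submod : submod_closed in_l2.
Proof.
split; first by apply/mem_set; rewrite /= sq_sum0.
move=> c f h /set_mem/= fl /set_mem/= hl; apply/mem_set => /=.
pose k := 2 * (complex.Re `|c| ^+ 2 + 1).
have c0 : (complex.Re `|c|)%:C = `|c| by rewrite RRe_real// ger0_real.
apply: (@esum_dom _ (fun g => hnorm (f g) ^+ 2 + hnorm (h g) ^+ 2) k).
- by rewrite mulr_ge0// addr_ge0// sqr_ge0.
- by move=> g; rewrite addr_ge0// sqr_ge0.
- move=> g; set x := hnorm (f g); set y := hnorm (h g).
  have : hnorm (c *: f g + h g) <= complex.Re `|c| * x + y.
    by rewrite -lecR rmorphD rmorphM /= c0 !hnormE -normrZ ler_normD.
  move=> le1; set z := hnorm _ in le1 *.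
  have z0 : 0 <= z by exact: hnorm_ge0.
  set d := complex.Re `|c| in le1 k *.
  have h1 : z ^+ 2 <= (d * x + y) ^+ 2.
    by rewrite ler_pXn2r// nnegrE// (le_trans z0).
  rewrite (le_trans h1)// /k; have := sqr_ge0 (d * x - y).
  have := sqr_ge0 (d * y); have := sqr_ge0 x; have := sqr_ge0 y.
  by nra.
- under eq_esum do rewrite EFinD.
  rewrite esumD; first exact: lte_add_pinfty.
  + by move=> g _; rewrite lee_fin sqr_ge0.
  + by move=> g _; rewrite lee_fin sqr_ge0.
Qed.

Record l2 := L2 { l2_val :> G -> H; l2_valP : l2_val \in in_l2 }.

HB.instance Definition _ := [isSub for l2_val].
HB.instance Definition _ := [Choice of l2 by <:].
HB.instance Definition _ :=
  GRing.isSubmodClosed.Build R[i] (G -> H) in_l2 l2_submod.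
HB.instance Definition _ := [SubChoice_isSubLmodule of l2 by <:].

(* Unordered sum of an absolutely summable real family. *)
Definition rsum (u : G -> R) : R :=
  fine (\esum_(g in [set: G]) ((EFin \o u)^\+ g))%E -
  fine (\esum_(g in [set: G]) ((EFin \o u)^\- g))%E.

(* <f, h> = \sum_g <f g, h g>. *)
Definition l2_dot (f h : l2) : R[i] :=
  rsum (fun g => complex.Re (hdot (f g) (h g))) +i*
  rsum (fun g => complex.Im (hdot (f g) (h g))).

Definition l2_norm (f : l2) : R := Num.sqrt (fine (sq_sum f)).

Lemma translate_subproof (s : G) (f : l2) :
  (fun t => f (s^-1 * t)%g) \in in_l2.
Proof.
apply/mem_set => /=; have /set_mem/= := l2_valP f.
rewrite /sq_sum (reindex_esum setT setT (fun t => (s^-1 * t)%g))//.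
split=> // [x y _ _ /mulgI //|y _]; exists (s * y)%g => //.
by rewrite mulKg.
Qed.

(* lambda_s : delta_t |-> delta_(s t) *)
Definition translate (s : G) (f : l2) : l2 := L2 (translate_subproof s f).

End L2.

Section ReducedCrossedProduct.
Variables (R : realType) (G : groupType) (A : cstarType R).
Variables (act : cstar_action G A) (pi : faithful_representation A).

Lemma regrep_subproof (a : A) (f : l2 G (rep_space pi)) :
  (fun t => pi (act t^-1%g a) (f t)) \in @in_l2 R G (rep_space pi).
Proof.
apply/mem_set => /=; have /set_mem/= fl := l2_valP f.
apply: esum_dom fl => [|g|g]; first exact: (sqr_ge0 (cnorm a + 1)).
  exact: sqr_ge0.
rewrite -exprMn ler_pXn2r ?nnegrE ?mulr_ge0 ?hnorm_ge0 ?addr_ge0 ?cnorm_ge0//.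
rewrite -lecR rmorphM /= !hnormE.
apply: (@rep_contractive R A (rep_space pi) (fun a v => pi (act g^-1%g a) v)).
- by move=> c x y v; rewrite linearP rep_linear.
- by move=> v; rewrite rmorph1 rep_one.
- by move=> x y v; rewrite rmorphM rep_mul.
- by move=> x v w; rewrite rep_star -cs_act_star.
- by rewrite ltrDl.
Qed.

(* pi(a) : v delta_t |-> alpha_(t^-1)(a) v delta_t *)
Definition regrep (a : A) (f : l2 G (rep_space pi)) : l2 G (rep_space pi) :=
  L2 (regrep_subproof a f).

(* The operator a lambda_g. *)
Definition crossed_op (a : A) (g : G) :
    l2 G (rep_space pi) -> l2 G (rep_space pi) :=
  regrep a \o translate g.

(* Closure in operator norm of the span of the a lambda_g; a uniform limit on
   the unit ball of bounded linear operators is bounded and linear. *)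
Definition reduced_crossed_product :
    set (l2 G (rep_space pi) -> l2 G (rep_space pi)) :=
  [set T | forall e : R, 0 < e ->
     exists2 T0, lspan [set T1 | exists a g, T1 = crossed_op a g] T0 &
       forall xi, l2_norm (T xi - T0 xi) <= e * l2_norm xi].

End ReducedCrossedProduct.

Arguments crossed_op {R G A} act pi a g _.
Arguments reduced_crossed_product {R G A} act pi _.

Section OsCrossedProduct.
Variables (R : realType) (G : groupType) (S : operatorSystemType R).
Variables (alpha : os_action G S) (E : cstar_envelope S).
Variables (act : extended_action alpha E).
Variables (pi : faithful_representation (env_alg E)) (gens : set G).

Definition os_crossed_ops : set (l2 G (rep_space pi) -> l2 G (rep_space pi)) :=
  [set T | exists s g, gens g /\ T = crossed_op act pi (env_emb E s) g].

Definition os_crossed := span_type os_crossed_ops.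

Lemma os_crossed_sub (x : os_crossed) :
  reduced_crossed_product act pi (span_val x).
Proof.
move=> e e0; have /set_mem[n [c [T [ST ->]]]] := span_valP x.
exists (\sum_i c i *: T i) => [|xi].
  exists n, c, T; split=> // i.
  by have [s [g [_ ->]]] := ST i; exists (env_emb E s), g.
rewrite subrr /l2_norm sq_sum0 sqrtr0 mulr_ge0 ?sqrtr_ge0//; exact: ltW.
Qed.

Lemma os_crossed_elt_subproof s g : gens g ->
  os_crossed_ops (crossed_op act pi (env_emb E s) g).
Proof. by move=> ?; exists s, g. Qed.

Definition os_crossed_elt s g (hg : gens g) : os_crossed :=
  span_gen (os_crossed_elt_subproof s hg).

Definition os_crossed_unit (h1 : gens 1%g) : os_crossed :=
  os_crossed_elt (os_unit S) h1.

Lemma os_crossed_unitE (h1 : gens 1%g) : span_val (os_crossed_unit h1) = id.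
Proof.
apply/funext => xi; apply/val_inj/funext => t /=.
by rewrite (cover_unital (env_cover E)) rmorph1 rep_one invg1 mul1g.
Qed.

(* X is positive as an operator on l^2(G, H)^n; this is the order that M_n(B)
   carries for every C*-algebra B of operators on l^2(G, H), in particular for
   the reduced crossed product. *)
Definition os_crossed_pos : mx_cones os_crossed := fun n =>
  [set X | forall xi : 'I_n -> l2 G (rep_space pi),
     0 <= \sum_i \sum_j l2_dot (span_val (X i j) (xi j)) (xi i)].

End OsCrossedProduct.

Arguments os_crossed_pos {R G S alpha E} act pi gens n.

(* Main.v *)
Require Import Defs.
From HB Require Import structures.
From mathcomp Require Import all_boot all_order all_algebra finmap.
From mathcomp Require Import complex.
From mathcomp Require Import all_classical all_reals.
From mathcomp Require Import ereal esum numfun topology normedtype sequences.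
From mathcomp Require Import ring lra.

(** Write an element of the reduced crossed product as a finite sum
    x = sum_g a(g) lambda_g. On vectors supported at one point it acts by
      x (delta_s v) (t) = pi (alpha_(t^-1) (a (t s^-1))) v,
    so that, in the basis of G, x is a Toeplitz-like matrix whose entries lie
    in S itself. Three consequences give the theorem.
    - The coefficients a(g) are determined by the operator x, because pi is
      faithful (crossed_sum_inj). Hence applying phi to the coefficients is a
      well defined linear map phit.
    - A matrix X over the crossed product is positive if and only if each of
      its finite sections, a matrix with entries
      alpha_(t_k^-1) (a_(i_k i_l) (t_k t_l^-1)), is positive over S
      (crossed_form_ge0P).
    - An equivariant phi maps the sections of X entrywise to those of phit X
      (toeplitz_mx_map). So phit inherits complete positivity from phi, and
      reflects positivity when phi does.

    The criterion for positivity rests on two facts. First, positivity on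
    finitely supported vectors implies positivity on l^2(G, H)
    (crossed_form_part_ge0): the terms of the truncated double sum are
    dominated by a summable family that does not depend on the truncation.
    Second, a matrix over S is positive as soon as its image is a positive
    operator on H^N (os_pos_rep): a faithful representation pi of a C*-algebra
    A reflects positivity, also on matrices.

    For 1 x 1 matrices (rep_ge0_cnormB1), let k be the absolute value of a
    self-adjoint w with pi(w) >= 0, and m = k - w twice its negative part. Then
    m w m = - m k m, and the image of the left side is >= 0, that of the right
    side <= 0. So both vanish, which forces m = 0 and w = k. The square root
    that defines k is the limit of an iteration; this converges because
    cnorm (1 - w^2) <= 1 when cnorm w <= 1, as w is then the imaginary part of a
    unitary.
    For larger matrices (mx_rep_gt0_cstar_pos), Schur complements give a
    Cholesky factorization Y^* Y of any strictly positive matrix, by induction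
    on the size; in this way only the norm of A itself is ever used. The
    Archimedean axiom of S then passes from strictly positive to positive. *)

Set Implicit Arguments.
Unset Strict Implicit.
Unset Printing Implicit Defensive.

Import Order.TTheory GRing.Theory Num.Theory.
Import numFieldNormedType.Exports.

Local Open Scope classical_set_scope.
Local Open Scope ring_scope.
Local Open Scope complex_scope.

(** * Limits and square roots in a C*-algebra *)

Section CnormCvg.
Variables (R : realType) (A : cstarType R).
Implicit Types (x y z : A) (u w : nat -> A).

Definition cnorm_cvg u x := (fun n => cnorm (u n - x)) @ \oo --> (0 : R).

Lemma cnorm_cvgP u x : cnorm_cvg u x <->
  forall e : R, 0 < e -> exists N, forall n, (N <= n)%N -> cnorm (u n - x) < e.
Proof.
split=> [h e e0|h].
  have /cvgrPdist_lt /(_ _ e0) [N _ hN] := h.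
  exists N => n Nn; have := hN n Nn.
  by rewrite /= sub0r normrN ger0_norm// cnorm_ge0.
apply/cvgrPdist_lt => e /h[N hN]; exists N => // n /= Nn.
by rewrite sub0r normrN ger0_norm ?cnorm_ge0// hN.
Qed.

Lemma cnorm_cvg_dom u x (a : nat -> R) :
  (forall n, cnorm (u n - x) <= a n) -> a @ \oo --> (0 : R) -> cnorm_cvg u x.
Proof.
move=> ua a0; apply: (squeeze_cvgr _ (cvg_cst 0) a0).
by near=> n; rewrite cnorm_ge0 ua.
Unshelve. all: by end_near. Qed.

Lemma cnorm_cvg_unique u x y : cnorm_cvg u x -> cnorm_cvg u y -> x = y.
Proof.
move=> ux uy; apply/eqP; rewrite -subr_eq0; apply/eqP/cnorm_eq0/le_anti.
rewrite cnorm_ge0 andbT.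
have uxy : (fun n => cnorm (u n - x) + cnorm (u n - y)) @ \oo --> (0 : R).
  by rewrite -(addr0 0); exact: cvgD.
apply: (ler_cvg_to (cvg_cst (cnorm (x - y))) uxy); apply: nearW => n /=.
rewrite (cnormB (u n) x) (le_trans _ (cnormD _ _))//.
by rewrite addrA subrK.
Qed.

Lemma cnorm_cvg_cst x : cnorm_cvg (fun=> x) x.
Proof. by apply: (cnorm_cvg_dom (a := fun=> 0)); [move=> n;
  rewrite subrr cnorm0|exact: cvg_cst]. Qed.

Lemma cnorm_cvg_shift u x : cnorm_cvg u x -> cnorm_cvg (fun n => u n.+1) x.
Proof. by rewrite /cnorm_cvg (cvg_shiftS (fun n => cnorm (u n - x))). Qed.

Lemma cnorm_cvgD u w x y :
  cnorm_cvg u x -> cnorm_cvg w y -> cnorm_cvg (fun n => u n + w n) (x + y).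
Proof.
move=> ux wy.
apply: (cnorm_cvg_dom (a := fun n => cnorm (u n - x) + cnorm (w n - y))).
  by move=> n /=; rewrite opprD addrACA cnormD.
by rewrite -(addr0 0); exact: cvgD.
Qed.

Lemma cnorm_cvgM u w x y :
  cnorm_cvg u x -> cnorm_cvg w y -> cnorm_cvg (fun n => u n * w n) (x * y).
Proof.
move=> ux wy.
apply: (cnorm_cvg_dom (a := fun n => cnorm (u n - x) * cnorm (w n - y) +
  (cnorm (u n - x) * cnorm y + cnorm x * cnorm (w n - y)))); last first.
  have -> : 0 = 0 * 0 + (0 * cnorm y + cnorm x * 0) :> R.
    by rewrite !mulr0 mul0r !addr0.
  apply: cvgD; first exact: cvgM.
  by apply: cvgD; apply: cvgM => //; exact: cvg_cst.
move=> n /=.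
have -> : u n * w n - x * y =
    (u n - x) * (w n - y) + ((u n - x) * y + x * (w n - y)).
  rewrite addrA -mulrDr subrK !(mulrBl, mulrBr) addrA subrK.
  by [].
apply: le_trans (cnormD _ _) _; apply: lerD (cnormM _ _) _.
by apply: le_trans (cnormD _ _) _; apply: lerD (cnormM _ _) (cnormM _ _).
Qed.

Lemma cnorm_cvg_star u x :
  cnorm_cvg u x -> cnorm_cvg (fun n => star (u n)) (star x).
Proof.
move=> ux; apply: cnorm_cvg_dom ux => n.
by rewrite -starN -starD cnorm_star.
Qed.

Lemma cnorm_cvg_le u x (M : R) :
  (forall n, cnorm (u n) <= M) -> cnorm_cvg u x -> cnorm x <= M.
Proof.
move=> uM ux; have uxM : (fun n => M + cnorm (u n - x)) @ \oo --> M.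
  by rewrite -{2}(addr0 M); apply: cvgD => //; exact: cvg_cst.
apply: (ler_cvg_to (cvg_cst (cnorm x)) uxM); apply: nearW => n /=.
rewrite cnormB -(subrK (u n) x) [leLHS](_ : _ = cnorm (x - u n + u n))//.
by rewrite (le_trans (cnormD _ _))// addrC subrK lerD2r uM.
Qed.

(** Comparison with a bounded monotone real sequence: the increments of u are
    bounded by those of v, so that u inherits from v the Cauchy property. *)
Lemma cnorm_dominated_cvg u (v : nat -> R) (M : R) :
  (forall n, cnorm (u n.+1 - u n) <= v n.+1 - v n) -> (forall n, v n <= M) ->
  exists x, cnorm_cvg u x.
Proof.
move=> uv vM.
have vn n : v n <= v n.+1 by rewrite -subr_ge0 (le_trans (cnorm_ge0 _) (uv n)).
have vmono : {homo v : n m / (n <= m)%N >-> n <= m}.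
  by apply: homo_leq => // y x z; exact: le_trans.
have v_cvg : cvgn v.
  by apply: nondecreasing_is_cvgn => //; exists M => _ [n _ <-].
have uvD n k : cnorm (u (n + k)%N - u n) <= v (n + k)%N - v n.
  elim: k => [|k IH]; first by rewrite addn0 !subrr cnorm0.
  have := cnormD (u (n + k).+1 - u (n + k)%N) (u (n + k)%N - u n).
  by rewrite addrA subrK addnS; have := uv (n + k)%N; lra.
have [x ux] : exists l, forall e : R, 0 < e -> exists N, forall n,
    (N <= n)%N -> cnorm (u n - l) < e; last by exists x; apply/cnorm_cvgP.
apply: cnorm_complete => e e0; have e20 : 0 < e / 2 by rewrite divr_gt0.
have /cvgrPdist_lt /(_ _ e20) [N _ hN] := v_cvg.
exists N => m n Nm Nn.
have vl k := nondecreasing_cvgn_le vmono v_cvg k.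
have := hN N (leqnn N) => /=; rewrite ger0_norm ?subr_ge0// => vN.
have := uvD N (m - N)%N; have := uvD N (n - N)%N; rewrite !subnKC// => h1 h2.
have := cnormD (u m - u N) (u N - u n).
rewrite addrA subrK (cnormB (u N)); have := vl m; have := vl n; lra.
Qed.

End CnormCvg.

Section SquareRoot.
Variables (R : realType) (A : cstarType R).
Implicit Types (x y z : A).

(** The power series of 1 - sqrt(1 - x) has nonnegative coefficients of sum 1,
    so it still converges when cnorm x = 1; here it is replaced by the iteration
    p := (x + p^2) / 2, run in parallel on the scalar x = 1. The last conclusion
    says that the root lies in the bicommutant of x. *)
Lemma cstar_sqrt_closed x : star x = x -> cnorm x <= 1 ->
  exists p : A, [/\ star p = p, cnorm p <= 1, (1 - p) * (1 - p) = 1 - x &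
    forall z, z * x = x * z -> z * p = p * z].
Proof.
move=> xJ x1.
pose F y := (2^-1 : R[i]) *: (x + y * y); pose u n := iter n F 0.
pose v n := iter n (fun t : R => (1 + t * t) / 2) 0.
have v01 n : 0 <= v n <= 1.
  by elim: n => [|n] /=; [rewrite lexx ler01|rewrite -/(v n); nra].
have uv n : cnorm (u n) <= v n.
  elim: n => [|n IH] /=; first by rewrite cnorm0.
  rewrite -/(u n) -/(v n) cnormZ Re_half.
  have := cnormD x (u n * u n); have := cnormM (u n) (u n).
  have := cnorm_ge0 (u n); have := v01 n; nra.
have uvB n : cnorm (u n.+1 - u n) <= v n.+1 - v n.
  elim: n => [|n IH]; first by rewrite /= !subr0 mulr0 addr0 /F mulr0 addr0
    cnormZ Re_half; lra.
  have -> : u n.+2 - u n.+1 =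
      (2^-1 : R[i]) *: (u n.+1 * (u n.+1 - u n) + (u n.+1 - u n) * u n).
    rewrite mulrBr mulrBl addrA subrK -[LHS]scalerBr opprD addrACA subrr.
    by rewrite add0r.
  rewrite cnormZ Re_half.
  have := cnormD (u n.+1 * (u n.+1 - u n)) ((u n.+1 - u n) * u n).
  have := cnormM (u n.+1) (u n.+1 - u n); have := cnormM (u n.+1 - u n) (u n).
  have := ler_pM (cnorm_ge0 _) (cnorm_ge0 _) (uv n.+1) IH.
  have := ler_pM (cnorm_ge0 _) (cnorm_ge0 _) IH (uv n).
  have -> : v n.+2 - v n.+1 = (v n.+1 * v n.+1 - v n * v n) / 2.
    by rewrite -[v n.+2]/((1 + v n.+1 * v n.+1) / 2) -[X in _ - X]/((1 + v n *
      v n) / 2); field.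
  lra.
have [p up] : exists p, cnorm_cvg u p.
  by apply: cnorm_dominated_cvg uvB _ => n; case/andP: (v01 n) => _; apply.
have uJ n : star (u n) = u n.
  elim: n => [|n IH] /=; first exact: star0.
  by rewrite starZ starD starM -/(u n) IH xJ fmorphV rmorph_nat.
have p2 : p + p = x + p * p.
  have /cnorm_cvg_shift upS := up.
  apply: (cnorm_cvg_unique (cnorm_cvgD upS upS)).
  rewrite (_ : (fun n => _) = (fun n => x + u n * u n)).
    exact: cnorm_cvgD (cnorm_cvg_cst x) (cnorm_cvgM up up).
  apply/funext => n; rewrite -mulr2n -scaler_nat [u n.+1]/(F (u n)) /F.
  by rewrite scalerA divff// scale1r.
exists p; split.
- apply: (cnorm_cvg_unique (cnorm_cvg_star up)).
  by rewrite (_ : (fun n => _) = u)//; apply/funext.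
- apply: cnorm_cvg_le up => n; case/andP: (v01 n) => _; exact: le_trans.
- by rewrite mulrBl mul1r mulrBr mulr1 -addrA -opprD addrA p2 addrK.
- move=> z zx; apply: (cnorm_cvg_unique (cnorm_cvgM (cnorm_cvg_cst z) up)).
  rewrite (_ : (fun n => _) = (fun n => u n * z)).
    exact: cnorm_cvgM up (cnorm_cvg_cst z).
  apply/funext; elim=> [|n IH] /=; first by rewrite mul0r mulr0.
  rewrite -/(u n) -scalerAl -scalerAr mulrDr mulrDl zx mulrA IH -mulrA IH.
  by rewrite mulrA.
Qed.

End SquareRoot.

Section Neumann.
Variables (R : realType) (A : cstarType R).
Implicit Types (x y z : A).

Lemma cnorm1_le1 : cnorm (1 : A) <= 1.
Proof.
have := cnorm_starM (1 : A); rewrite star1 mulr1 => h.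
rewrite leNgt; apply/negP => h1.
nra.
Qed.

(** The geometric series, as the limit of the iteration l := 1 + z l. *)
Lemma neumann_inverse z (q : R) : cnorm z <= q -> q < 1 ->
  exists l, (1 - z) * l = 1.
Proof.
move=> zq q1; have q0 : 0 <= q := le_trans (cnorm_ge0 z) zq.
pose u n := iter n (fun l => 1 + z * l) 0.
have uS n : u n.+1 = 1 + z * u n by [].
have uB n : cnorm (u n.+1 - u n) <= q ^+ n.
  elim: n => [|n IH]; first by rewrite /= mulr0 addr0 subr0 expr0 cnorm1_le1.
  rewrite uS uS opprD addrACA subrr add0r -mulrBr exprS.
  by apply: le_trans (cnormM _ _) _; rewrite ler_pM ?cnorm_ge0.
have [l ul] : exists l, cnorm_cvg u l.
  apply: (@cnorm_dominated_cvg _ _ _ (fun n =>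
    (1 - q ^+ n) / (1 - q)) (1 - q)^-1).
    move=> n; have -> // : (1 - q ^+ n.+1) / (1 - q) - (1 - q ^+ n) / (1 - q) =
      q ^+ n.
    by rewrite exprS; field; rewrite subr_eq0 eq_sym lt_eqF.
  by move=> n; rewrite ler_pdivrMr ?subr_gt0// mulVf ?subr_eq0 ?gt_eqF// gerBl
    exprn_ge0.
exists l; rewrite mulrBl mul1r; apply/eqP; rewrite subr_eq; apply/eqP.
apply: (cnorm_cvg_unique (cnorm_cvg_shift ul)).
by apply: cnorm_cvgD (cnorm_cvg_cst 1) (cnorm_cvgM (cnorm_cvg_cst z) ul).
Qed.

(** c is the real part of the unitary c + i x, and unitaries have norm 1. *)
Lemma cnorm_cos_le1 c x : star c = c -> star x = x -> c * x = x * c ->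
  c * c + x * x = 1 -> cnorm c <= 1.
Proof.
move=> cJ xJ cx sq1; pose u := c + 'i%R *: x.
have uJ : star u = c - 'i%R *: x by rewrite starD starZ cJ xJ conjCi scaleNr.
have u1 : cnorm u <= 1.
  have : cnorm u ^+ 2 <= 1.
    rewrite -cnorm_starM uJ [_ * u](_ : _ = c * c + x * x).
      by rewrite sq1 cnorm1_le1.
    have iC : ('i%R *: x) * c = c * ('i%R *: x).
      by rewrite -scalerAl -scalerAr cx.
    have ii : ('i%R *: x) * ('i%R *: x) = - (x * x).
      by rewrite -scalerAl -scalerAr scalerA -expr2 sqrCi scaleN1r.
    by rewrite mulrBl !mulrDr iC ii opprD opprK addrA addrK.
  by have := cnorm_ge0 u; nra.
have -> : c = (2^-1 : R[i]) *: (u + star u).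
  rewrite uJ addrACA subrr addr0 -mulr2n -[c *+ 2]scaler_nat scalerA.
  by rewrite mulVf ?pnatr_eq0// scale1r.
rewrite cnormZ Re_half; have := cnormD u (star u); rewrite cnorm_star; lra.
Qed.

End Neumann.

(** * Positive operators in the image of a faithful representation *)

Section InnerProduct.
Variables (R : realType) (H : hilbertType R).
Implicit Types (u v w : H).

Lemma hdotDl u v w : hdot (u + v) w = hdot u w + hdot v w.
Proof. exact: linearDl. Qed.

Lemma hdotNl v w : hdot (- v) w = - hdot v w.
Proof. exact: linearNl. Qed.

Lemma hdot0l w : hdot (0 : H) w = 0.
Proof. exact: linear0l. Qed.

Lemma hdotZl c v w : hdot (c *: v) w = c * hdot v w.
Proof. exact: linearZl_LR. Qed.

Lemma hdotDr u v w : hdot w (u + v) = hdot w u + hdot w v.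
Proof. exact: linearDr. Qed.

Lemma hdotNr v w : hdot w (- v) = - hdot w v.
Proof. exact: linearNr. Qed.

Lemma hdot0r w : hdot w (0 : H) = 0.
Proof. exact: linear0r. Qed.

Lemma hdotZr c v w : hdot w (c *: v) = Num.conj c * hdot w v.
Proof. exact: linearZr_LR. Qed.

Lemma hdotC v w : hdot v w = Num.conj (hdot w v).
Proof. by rewrite hermC expr0 mul1r. Qed.

Lemma hdot_suml I (r : seq I) (P : pred I) (F : I -> H) w :
  hdot (\sum_(i <- r | P i) F i) w = \sum_(i <- r | P i) hdot (F i) w.
Proof. by elim/big_ind2: _ => [|a x b y <- <-|]; rewrite ?hdot0l ?hdotDl. Qed.

Lemma hdot_sumr I (r : seq I) (P : pred I) (F : I -> H) w :
  hdot w (\sum_(i <- r | P i) F i) = \sum_(i <- r | P i) hdot w (F i).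
Proof. by elim/big_ind2: _ => [|a x b y <- <-|]; rewrite ?hdot0r ?hdotDr. Qed.

Lemma hdot_ge0 v : 0 <= hdot v v.
Proof. by rewrite hdot_norm exprn_ge0. Qed.

Lemma hdot_eq0 v : hdot v v <= 0 -> v = 0.
Proof.
move=> h; apply/eqP; rewrite -normr_eq0 -sqrf_eq0 -hdot_norm; apply/eqP.
by apply/le_anti; rewrite h hdot_ge0.
Qed.

End InnerProduct.

Section FaithfulPositivity.
Variables (R : realType) (A : cstarType R) (pi : faithful_representation A).
Implicit Types (a x y w : A).
Local Notation H := (rep_space pi).

Definition rep_ge0 y := forall v : H, 0 <= hdot (pi y v) v.

Lemma rep0 v : pi 0 v = 0.
Proof.
by rewrite -(subrr (0 : A)) -scaleN1r addrC rep_linear scaleN1r addNr.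
Qed.

Lemma repZ c a v : pi (c *: a) v = c *: pi a v.
Proof. by rewrite -[c *: a]addr0 rep_linear rep0 addr0. Qed.

Lemma repD a b v : pi (a + b) v = pi a v + pi b v.
Proof. by rewrite -[a]scale1r rep_linear !scale1r. Qed.

Lemma repN a v : pi (- a) v = - pi a v.
Proof. by rewrite -scaleN1r repZ scaleN1r. Qed.

Lemma repB a b v : pi (a - b) v = pi a v - pi b v.
Proof. by rewrite repD repN. Qed.

Lemma rep_sum I (r : seq I) (P : pred I) (F : I -> A) v :
  pi (\sum_(i <- r | P i) F i) v = \sum_(i <- r | P i) pi (F i) v.
Proof. by elim/big_ind2: _ => [|a x b y <- <-|]; rewrite ?rep0 ?repD. Qed.

Lemma rep_starM y v : hdot (pi (star y * y) v) v = hdot (pi y v) (pi y v).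
Proof. by rewrite rep_mul rep_star starK. Qed.

(** A faithful representation reflects positivity: if pi(w) >= 0 then w = |w|,
    whence the bound. With k = |w| and m = k - w one has m w = - m k, so that
    m w m is sent to an operator that is both >= 0 and <= 0. *)
Lemma rep_ge0_cnormB1 w : star w = w -> cnorm w <= 1 -> rep_ge0 w ->
  cnorm (1 - w) <= 1.
Proof.
move=> wJ w1 w_ge0.
have w2J : star (w * w) = w * w by rewrite starM wJ.
have ww1 : cnorm (w * w) <= 1.
  by rewrite (le_trans (cnormM _ _))// mulr_ile1 ?cnorm_ge0.
have [p [pJ _ pp pC]] := cstar_sqrt_closed w2J ww1.
have c1 : cnorm (1 - p) <= 1.
  apply: (@cnorm_cos_le1 _ _ _ w) => //.
  - by rewrite starD starN star1 pJ.
  - by rewrite mulrBl mulrBr mul1r mulr1 pC// mulrA.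
  - by rewrite pp subrK.
have xJ : star (1 - w * w) = 1 - w * w by rewrite starD starN star1 w2J.
have x1 : cnorm (1 - w * w) <= 1.
  by rewrite -pp (le_trans (cnormM _ _))// mulr_ile1 ?cnorm_ge0.
have [q [qJ q1 qq qC]] := cstar_sqrt_closed xJ x1.
(* k = 1 - q is |w|; its square root s makes m k m the square (s m)^* (s m). *)
have [r [rJ _ rr _]] := cstar_sqrt_closed qJ q1.
have {}qC : w * q = q * w.
  by apply: qC; rewrite mulrBl mulrBr mul1r mulr1 mulrA.
set k := 1 - q in qq rr *; set s := 1 - r in rr *.
have kJ : star k = k by rewrite starD starN star1 qJ.
have sJ : star s = s by rewrite starD starN star1 rJ.
have kw : k * w = w * k by rewrite mulrBl mulrBr mul1r mulr1 qC.
have kE : k = 1 - q by [].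
clearbody k s; rewrite opprB addrC subrK in qq.
pose m := k - w; have mJ : star m = m by rewrite starD starN kJ wJ.
have mk : m * k = - (m * w).
  apply/eqP; rewrite -addr_eq0 -mulrDr /m mulrBl !mulrDr qq kw.
  by rewrite opprD addrA addrK subrr.
have mwm v : hdot (pi (m * w * m) v) v = hdot (pi w (pi m v)) (pi m v).
  by rewrite -mulrA rep_mul rep_star mJ rep_mul.
have mkm v : hdot (pi (m * k * m) v) v = hdot (pi (s * m) v) (pi (s * m) v).
  by rewrite -rep_starM starM mJ sJ mulrA -(mulrA m s) rr.
have sm : s * m = 0.
  apply: rep_faithful => v.
  have : hdot (pi (s * m) v) (pi (s * m) v) <= 0; last exact: hdot_eq0.
  rewrite -mkm mk mulNr repN hdotNl mwm oppr_le0; exact: w_ge0.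
have km : k * m = 0 by rewrite -rr -mulrA sm mulr0.
have mk0 : m * k = 0 by rewrite -[m * k]starK starM mJ kJ km star0.
have mw0 : m * w = 0 by apply/eqP; rewrite -oppr_eq0 -mk mk0.
have m0 : m = 0.
  apply: cnorm_eq0; apply/eqP; rewrite -sqrf_eq0 -cnorm_starM mJ.
  by rewrite {2}/m mulrBr mk0 mw0 subrr cnorm0.
have -> : w = k by apply/esym/eqP; rewrite -subr_eq0 -/m m0.
by rewrite kE opprB addrC subrK.
Qed.

(** If t > cnorm (y - r) then y = (t + r)(1 - z) with
    cnorm z <= t / (t + r) < 1, by the preceding lemma applied to (y - r) / t.
    Both the square root and the inverse of 1 - z are then given by convergent
    series. *)
Lemma rep_gt0_sqrt y (r : R) : star y = y -> 0 < r -> rep_ge0 (y - r%:C%:A) ->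
  exists d, exists e,
    [/\ star d = d, star e = e, d * d = y, d * e = 1 & e * d = 1].
Proof.
move=> yJ r0 yr.
have rJ (t : R) : star (t%:C%:A : A) = t%:C%:A.
  by rewrite starZ star1 conj_Creal// complex_real.
(* The summand 1 keeps t > 0 when y = r. *)
pose t := cnorm (y - r%:C%:A) + 1.
have t0 : 0 < t by rewrite ltr_wpDl ?cnorm_ge0.
have absC (s : R) : 0 <= s -> complex.Re `|s%:C| = s.
  by move=> s0; rewrite ger0_norm// ler0c.
pose w := (t^-1)%:C *: (y - r%:C%:A).
have wJ : star w = w.
  by rewrite starZ starD starN rJ yJ conj_Creal// complex_real.
have ti0 : 0 <= t^-1 by rewrite invr_ge0 ltW.
have w1 : cnorm w <= 1.
  by rewrite cnormZ absC// mulrC ler_pdivrMr// mul1r /t lerDl.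
have w_ge0 : rep_ge0 w.
  by move=> v; rewrite repZ hdotZl mulr_ge0 ?ler0c.
have tr0 : 0 < t + r by rewrite addr_gt0.
have q0 : 0 <= t / (t + r) by rewrite divr_ge0 // ltW.
have q1 : t / (t + r) < 1 by rewrite ltr_pdivrMr// mul1r ltrDl.
pose z := (t / (t + r))%:C *: (1 - w).
have zJ : star z = z.
  by rewrite starZ starD starN star1 wJ conj_Creal// complex_real.
have zq : cnorm z <= t / (t + r).
  by rewrite cnormZ absC// ler_piMr// rep_ge0_cnormB1.
have yE : y = (t + r)%:C *: (1 - z).
  rewrite /z /w scalerBr scalerA -rmorphM mulrCA divff ?gt_eqF// mulr1.
  rewrite [t%:C *: _]scalerBr scalerA -rmorphM divff ?gt_eqF// scale1r.
  by rewrite rmorphD scalerDl opprB addrC addrA !subrK.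
have [c cJ cc] := cstar_sqrt zJ (le_lt_trans zq q1).
have [l zl] := neumann_inverse zq q1.
pose b := Num.sqrt (t + r).
have b0 : b != 0 by rewrite gt_eqF// sqrtr_gt0.
have clc : c * (c * l) = 1 by rewrite mulrA cc.
pose d := b%:C *: c; pose e := (b^-1)%:C *: (c * l).
have dJ : star d = d by rewrite starZ cJ conj_Creal// complex_real.
have de : d * e = 1.
  by rewrite -scalerAl -scalerAr scalerA -rmorphM divff// scale1r clc.
have ed : star e * d = 1 by rewrite -{1}dJ -starM de star1.
have eJ : star e = e by rewrite -[LHS]mulr1 -de mulrA ed mul1r.
exists d, e; split=> //; last by rewrite -{1}eJ.
rewrite yE -scalerAl -scalerAr scalerA -rmorphM cc; congr (_%:C *: _).
by rewrite -expr2 sqr_sqrtr// ltW.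
Qed.

End FaithfulPositivity.

(** * Matrices that are positive operators *)

Section MatrixPositivity.
Variables (R : realType) (A : cstarType R) (pi : faithful_representation A).
Local Notation H := (rep_space pi).

Section Form.
Variable n : nat.
Implicit Types (X : 'M[A]_n) (v w : 'I_n -> H).

Definition mx_form X v w := \sum_i \sum_j hdot (pi (X i j) (v j)) (w i).

Definition mx_rep_ge0 X := forall v, 0 <= mx_form X v v.

Lemma mx_formDX X Y v w : mx_form (X + Y) v w = mx_form X v w + mx_form Y v w.
Proof.
rewrite /mx_form -big_split; apply: eq_bigr => i _ /=.
by rewrite -big_split; apply: eq_bigr => j _ /=; rewrite mxE repD hdotDl.
Qed.

Lemma mx_formNX X v w : mx_form (- X) v w = - mx_form X v w.
Proof.
rewrite /mx_form -sumrN; apply: eq_bigr => i _ /=.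
by rewrite -sumrN; apply: eq_bigr => j _ /=; rewrite mxE repN hdotNl.
Qed.

Lemma mx_formDl X v v' w :
  mx_form X (v + v') w = mx_form X v w + mx_form X v' w.
Proof.
rewrite /mx_form -big_split; apply: eq_bigr => i _ /=.
by rewrite -big_split; apply: eq_bigr => j _ /=; rewrite linearD hdotDl.
Qed.

Lemma mx_formDr X v w w' :
  mx_form X v (w + w') = mx_form X v w + mx_form X v w'.
Proof.
rewrite /mx_form -big_split; apply: eq_bigr => i _ /=.
by rewrite -big_split; apply: eq_bigr => j _ /=; rewrite hdotDr.
Qed.

Lemma mx_formZl X c v w : mx_form X (c *: v) w = c * mx_form X v w.
Proof.
rewrite /mx_form mulr_sumr; apply: eq_bigr => i _ /=.
by rewrite mulr_sumr; apply: eq_bigr => j _ /=; rewrite linearZ hdotZl.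
Qed.

Lemma mx_formZr X c v w : mx_form X v (c *: w) = Num.conj c * mx_form X v w.
Proof.
rewrite /mx_form mulr_sumr; apply: eq_bigr => i _ /=.
by rewrite mulr_sumr; apply: eq_bigr => j _ /=; rewrite hdotZr.
Qed.

Lemma mx_form_conj X v w :
  Num.conj (mx_form X v w) = mx_form (\matrix_(i, j) star (X j i)) w v.
Proof.
rewrite /mx_form rmorph_sum /=.
under eq_bigr do rewrite rmorph_sum.
rewrite exchange_big; apply: eq_bigr => i _; apply: eq_bigr => j _ /=.
by rewrite mxE -hdotC rep_star starK.
Qed.

(** Comparing the values at v + w and at i v + w isolates the form. *)
Lemma mx_form_polarization X : (forall v, mx_form X v v = 0) ->
  forall v w, mx_form X v w = 0.
Proof.
move=> X0 v w.
have h v' w' : mx_form X v' w' + mx_form X w' v' = 0.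
  have := X0 (v' + w'); rewrite mx_formDl !mx_formDr !X0 addr0 add0r.
  by [].
have /eqP := h v w; rewrite addr_eq0 => /eqP hw.
have := h ('i%R *: v) w; rewrite mx_formZl mx_formZr conjCi mulNr -mulrBr.
move=> /eqP; rewrite mulf_eq0 (negPf (neq0Ci _)) /= {1}hw -opprD oppr_eq0
  -mulr2n.
by rewrite mulrn_eq0 /= => /eqP wv; rewrite hw wv oppr0.
Qed.

Lemma mx_form_eq0 X : (forall v w, mx_form X v w = 0) -> X = 0.
Proof.
move=> X0; apply/matrixP => i j; rewrite mxE; apply: (@rep_faithful _ _ pi) =>
  v.
apply: hdot_eq0; rewrite le_eqVlt; apply/orP; left; apply/eqP.
rewrite -[RHS](X0 (fun l => if l == j then v else 0)
                  (fun k => if k == i then pi (X i j) v else 0)).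
rewrite /mx_form (bigD1 i)//= (bigD1 j)//= !eqxx big1 ?addr0 => [|l /negPf ->].
  rewrite big1 ?addr0// => k /negPf ->; rewrite big1// => l _.
  by rewrite hdot0r.
by rewrite linear0 hdot0l.
Qed.

(** The quadratic form of X is real, so that of X^* - X vanishes. *)
Lemma mx_rep_ge0_herm X : mx_rep_ge0 X -> forall i j, star (X i j) = X j i.
Proof.
move=> X0 i j; pose Y : 'M[A]_n := \matrix_(i, j) star (X j i).
have : Y - X = 0.
  apply/mx_form_eq0/mx_form_polarization => v.
  rewrite mx_formDX mx_formNX -mx_form_conj conj_Creal ?subrr//.
  exact/ger0_real/X0.
by move/matrixP => /(_ j i); rewrite !mxE => /eqP; rewrite subr_eq0 => /eqP.
Qed.

Lemma cstar_pos_rep_ge0 X : cstar_pos X -> mx_rep_ge0 X.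
Proof.
case=> Y -> v.
have -> : mx_form (\matrix_(i, j) \sum_k star (Y k i) * Y k j) v v =
    \sum_k hdot (\sum_j pi (Y k j) (v j)) (\sum_i pi (Y k i) (v i)).
  rewrite /mx_form.
  under eq_bigr do under eq_bigr do rewrite mxE rep_sum hdot_suml.
  under eq_bigr do rewrite exchange_big /=.
  rewrite exchange_big /=; apply: eq_bigr => k _; rewrite hdot_sumr.
  apply: eq_bigr => i _; rewrite hdot_suml; apply: eq_bigr => j _.
  by rewrite rep_mul rep_star starK.
by apply: sumr_ge0 => k _; exact: hdot_ge0.
Qed.

End Form.

Lemma mx_form_diag n (c : R[i]) (v w : 'I_n -> H) :
  mx_form (diag_const c%:A n) v w = c * \sum_i hdot (v i) (w i).
Proof.
rewrite mulr_sumr; apply: eq_bigr => i _.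
rewrite (bigD1 i)//= big1 ?addr0 => [|j].
  by rewrite mxE eqxx mulr1n repZ rep_one hdotZl.
by rewrite eq_sym => /negPf ij; rewrite mxE ij mulr0n rep0 hdot0l.
Qed.

(** Cholesky factorization: if d^2 is the corner X_00, with inverse e^2, and Z
    factors the Schur complement S, then the block matrix with rows
    (d, e X_0j) and (0, Z) factors X. The complement is again >= r, because its
    form at v is that of X at the vector V that extends v by the minimizing
    first component v0 = - e^2 sum_j X_0j v_j. *)
Lemma mx_rep_gt0_cstar_pos n (X : 'M[A]_n) (r : R) : 0 < r ->
  mx_rep_ge0 (X - diag_const r%:C%:A n) -> cstar_pos X.
Proof.
move=> r0; elim: n X => [|n IH] X Xr.
  by exists 0; apply/matrixP => -[].
have diag_ge0 v : 0 <= mx_form (diag_const r%:C%:A n.+1) v v.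
  rewrite mx_form_diag; apply: mulr_ge0; first by rewrite ler0c ltW.
  by apply: sumr_ge0 => i _; exact: hdot_ge0.
have X0 : mx_rep_ge0 X.
  move=> v; have := Xr v; rewrite mx_formDX mx_formNX subr_ge0.
  exact: le_trans.
have XJ := mx_rep_ge0_herm X0.
pose o : 'I_n.+1 := ord0; pose l := @lift n.+1 o.
have a_ge0 : rep_ge0 pi (X o o - r%:C%:A).
  move=> v; have := Xr (fun i => if i == o then v else 0).
  rewrite /mx_form big_ord_recl /= [X in _ + X]big1 => [|i _]; last first.
    by rewrite big1// => j _; rewrite hdot0r.
  rewrite addr0 big_ord_recl /= big1 ?addr0 => [|j _]; last first.
    by rewrite linear0 hdot0l.
  by rewrite !mxE eqxx mulr1n.
have [d [e [dJ eJ dd de ed]]] := rep_gt0_sqrt (XJ o o) r0 a_ge0.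
pose S : 'M[A]_n := \matrix_(i, j)
  (X (l i) (l j) - X (l i) o * (e * e) * X o (l j)).
have [Z SZ] : cstar_pos S.
  apply: IH => v; pose c := \sum_j pi (X o (l j)) (v j).
  pose v0 := - pi (e * e) c.
  pose V i := if unlift o i is Some j then v j else v0.
  have Vo : V o = v0 by rewrite /V unlift_none.
  have Vl j : V (l j) = v j by rewrite /V liftK.
  have av0 : pi (X o o) v0 = - c.
    by rewrite /v0 linearN -rep_mul -dd mulrA -(mulrA d d e) de mulr1 de
      rep_one.
  have form_S : mx_form S v v = mx_form X V V.
    rewrite [RHS]/mx_form big_ord_recl big_ord_recl Vo -/o av0 -hdot_suml.
    under eq_bigr do rewrite -/l Vl.
    rewrite -/c hdotNl addNr add0r; apply: eq_bigr => i _.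
    rewrite big_ord_recl -/o -/(l i) Vo Vl.
    under [in RHS]eq_bigr do rewrite -/o -/(l _) Vl.
    under [LHS]eq_bigr do rewrite mxE repB hdotDl hdotNl.
    rewrite big_split sumrN /= addrC; congr (_ + _).
    rewrite -hdot_suml -hdotNl /v0 linearN -rep_mul /c.
    rewrite [pi _ (\sum_(_ < _) _)]raddf_sum /=.
    congr (hdot (- _) _); apply: eq_bigr => j _.
    by rewrite -rep_mul.
  rewrite mx_formDX mx_formNX form_S mx_form_diag.
  have := Xr V; rewrite mx_formDX mx_formNX mx_form_diag big_ord_recl -/o Vo.
  under eq_bigr do rewrite -/o -/(l _) Vl.
  rewrite !subr_ge0 mulrDr; apply: le_trans; rewrite lerDr.
  by apply: mulr_ge0; [rewrite ler0c ltW|exact: hdot_ge0].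
pose Y : 'M[A]_n.+1 := \matrix_(i, j)
  match unlift o i, unlift o j with
  | None, None => d
  | None, Some j' => e * X o (l j')
  | Some _, None => 0
  | Some i', Some j' => Z i' j'
  end.
have Yoo : Y o o = d by rewrite mxE unlift_none.
have Yol j : Y o (l j) = e * X o (l j) by rewrite mxE unlift_none liftK.
have Ylo i : Y (l i) o = 0 by rewrite mxE unlift_none liftK.
have Yll i j : Y (l i) (l j) = Z i j by rewrite mxE !liftK.
have lE k : lift ord0 k = l k by [].
exists Y; apply/matrixP => i j; rewrite mxE big_ord_recl -/o.
under eq_bigr do rewrite lE.
have SZij i' j' : X (l i') (l j') =
    X (l i') o * (e * e) * X o (l j') + \sum_k star (Z k i') * Z k j'.
  by move/matrixP/(_ i' j'): SZ; rewrite !mxE => <-; rewrite addrC subrK.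
case: (unliftP o i) => [i'|] ->; case: (unliftP o j) => [j'|] ->;
  rewrite -?/(l _) ?Yoo ?Yol.
- rewrite SZij starM eJ XJ !mulrA; congr (_ + _); apply: eq_bigr => k _.
  by rewrite !Yll.
- rewrite big1 ?addr0 => [|k _]; last by rewrite Ylo mulr0.
  by rewrite starM eJ XJ -mulrA ed mulr1.
- rewrite big1 ?addr0 => [|k _]; last by rewrite Ylo star0 mul0r.
  by rewrite dJ mulrA de mul1r.
- rewrite big1 ?addr0 => [|k _]; last by rewrite Ylo mulr0.
  by rewrite dJ dd.
Qed.

End MatrixPositivity.

Section OperatorSystemCone.
Variables (R : realType) (S : operatorSystemType R) (E : cstar_envelope S).
Variable pi : faithful_representation (env_alg E).

(** The cone of S can be tested on any faithful representation of the envelope: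
    adding r > 0 makes a positive matrix strictly positive, and the Archimedean
    axiom removes r again. *)
Lemma os_pos_rep n (Z : 'M[S]_n) :
  os_pos S n Z <-> mx_rep_ge0 pi (map_mx (env_emb E) Z).
Proof.
have [_ coe] := cover_coe (env_cover E).
split=> [/coe /cstar_pos_rep_ge0|Zpos]; first exact.
apply: os_archimedean => r r0; apply/coe.
apply: (mx_rep_gt0_cstar_pos (pi := pi) r0).
have -> // : map_mx (env_emb E) (diag_const (r%:C *: os_unit S) n + Z) -
  diag_const r%:C%:A n = map_mx (env_emb E) Z.
apply/matrixP => i j; rewrite !mxE; case: (i == j);
  last by rewrite !mulr0n add0r subr0.
rewrite !mulr1n linearD linearZ_LR (cover_unital (env_cover E)).
by rewrite addrAC subrr add0r.
Qed.

End OperatorSystemCone.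

(** * Unordered sums and the inner product of l^2(G, H) *)

Section UnorderedSums.
Variables (R : realType) (G : choiceType).
Implicit Types (u w : G -> R) (F M : {fset G}).

(** Convergence of the net of finite partial sums, which is easier to add and
    to compare than the difference of two suprema that defines rsum. *)
Definition has_sum u (l : R) := forall e : R, 0 < e ->
  exists F0 : {fset G}, forall F : {fset G}, (F0 `<=` F)%fset ->
    `|\sum_(t <- F) u t - l| <= e.

Lemma fsum_sub (F M : {fset G}) u : (F `<=` M)%fset ->
  \sum_(t <- M) u t = \sum_(t <- F) u t + \sum_(t <- (M `\` F)%fset) u t.
Proof.
move=> FM; rewrite (big_fsetID _ (mem F))/=; congr (_ + _);
  apply: perm_big; apply: uniq_perm; rewrite ?fset_uniq// => x.
  rewrite !inE /= andbC; case: (boolP (x \in F)) => //= xF.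
  by rewrite (fsubsetP FM).
by rewrite !inE /= andbC.
Qed.

Lemma has_sum_unique u l l' : has_sum u l -> has_sum u l' -> l = l'.
Proof.
move=> ul ul'; apply/eqP; rewrite -subr_eq0 -normr_le0; apply/ler_addgt0Pl =>
  e e0.
have e2 : 0 < e / 2 by rewrite divr_gt0.
have [F hF] := ul _ e2; have [F' hF'] := ul' _ e2.
have := hF _ (fsubsetUl F F'); have := hF' _ (fsubsetUr F F').
rewrite addr0; set s := \sum_(_ <- _) _ => h1 h2.
have := ler_normD (l - s) (s - l'); rewrite addrA subrK (distrC l s); lra.
Qed.

Lemma has_sumD u w l m :
  has_sum u l -> has_sum w m -> has_sum (fun t => u t + w t) (l + m).
Proof.
move=> ul wm e e0; have e2 : 0 < e / 2 by rewrite divr_gt0.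
have [F hF] := ul _ e2; have [F' hF'] := wm _ e2.
exists (F `|` F')%fset => M; rewrite fsubUset => /andP[/hF h1 /hF' h2].
rewrite big_split opprD addrACA (le_trans (ler_normD _ _))//; lra.
Qed.

Lemma has_sumZ c u l : has_sum u l -> has_sum (fun t => c * u t) (c * l).
Proof.
move=> ul e e0; have [|F hF] := ul (e / (`|c| + 1)).
  by rewrite divr_gt0// ltr_wpDl.
exists F => M /hF; rewrite -mulr_sumr -mulrBr normrM ler_pdivlMr ?ltr_wpDl//.
by have := normr_ge0 (\sum_(t <- M) u t - l); have := normr_ge0 c; nra.
Qed.

Lemma has_sum_fin u F : (forall t, t \notin F -> u t = 0) ->
  has_sum u (\sum_(t <- F) u t).
Proof.
move=> u0 e e0; exists F => M FM; rewrite (fsum_sub _ FM) addrAC subrr add0r.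
rewrite big_seq big1 ?normr0 ?ltW// => t; rewrite inE => /andP[tF _].
exact: u0.
Qed.

Lemma has_sum_sum (I : Type) (r : seq I) (u : I -> G -> R) (l : I -> R) :
  (forall i, has_sum (u i) (l i)) ->
  has_sum (fun t => \sum_(i <- r) u i t) (\sum_(i <- r) l i).
Proof.
move=> ul; elim: r => [|i r IH].
  rewrite big_nil; have -> : (fun t => \sum_(i <- [::]) u i t) = fun=> 0.
    by apply/funext => t; rewrite big_nil.
  by have := @has_sum_fin (fun=> 0) fset0 (fun=> fun=> erefl);
    rewrite big_seq_fset0.
have -> : (fun t => \sum_(i <- i :: r) u i t) =
    (fun t => u i t + \sum_(i <- r) u i t).
  by apply/funext => t; rewrite big_cons.
by rewrite big_cons; exact: has_sumD.
Qed.

Lemma has_sum_esum u : (forall t, 0 <= u t) ->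
  (\esum_(t in [set: G]) (u t)%:E < +oo)%E ->
  has_sum u (fine (\esum_(t in [set: G]) (u t)%:E)%E).
Proof.
move=> u0 uoo; set s := (\esum_(t in _) _)%E in uoo *.
have s0 : (0 <= s)%E by apply: esum_ge0 => t _; rewrite lee_fin.
have sE : s \is a fin_num by rewrite ge0_fin_numE.
have le_s F : \sum_(t <- F) u t <= fine s.
  rewrite -lee_fin fineK// -sumEFin; apply: esum_ge; exists [set` F].
    by split.
  by rewrite fsbig_finite//= set_fsetK.
move=> e e0.
have [_ [F [finF _] <-]] := ub_ereal_sup_adherent e0 sE.
rewrite -[ereal_sup _]/s -(fineK sE) -EFinB fsbig_finite//= sumEFin lte_fin.
move=> sF.
exists (fset_set F) => M FM.
rewrite ler0_norm ?subr_le0// opprB lerBlDr.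
have : 0 <= \sum_(t <- (M `\` fset_set F)%fset) u t by apply: sumr_ge0.
by have := fsum_sub u FM; lra.
Qed.

(** Dominated convergence for signs: u' stands for a truncation of u that is
    exact on F, and only its sum over the larger set M is known to be >= 0. If
    F is large, the sum of u over F is close to l, and that of u' over the rest
    of M is bounded by a tail of w. *)
Lemma has_sum_ge0 u w l m : has_sum u l -> has_sum w m ->
  (forall F, exists2 M, (F `<=` M)%fset & exists2 u',
    (forall t, `|u' t| <= w t) /\ {in F, u' =1 u} & 0 <= \sum_(t <- M) u' t) ->
  0 <= l.
Proof.
move=> ul wm uM; apply/ler_addgt0Pl => e e0.
have e2 : 0 < e / 3 by rewrite divr_gt0.
have [F hF] := ul _ e2; have [F' hF'] := wm _ e2.
have [M FM [u' [u'w u'u] u'0]] := uM (F `|` F')%fset.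
have := hF _ (fsubsetUl F F'); rewrite ler_norml => /andP[_ h1].
have := hF' _ (fsubsetUr F F'); rewrite ler_norml => /andP[h2 _].
have := hF' _ (fsubset_trans (fsubsetUr F F') FM).
rewrite ler_norml => /andP[_ h3].
rewrite (fsum_sub _ FM) in u'0; rewrite (fsum_sub _ FM) in h3.
have uE : \sum_(t <- (F `|` F')%fset) u' t = \sum_(t <- (F `|` F')%fset) u t.
  by rewrite big_seq [RHS]big_seq; apply: eq_bigr => t; exact: u'u.
have : \sum_(t <- (M `\` (F `|` F'))%fset) u' t <=
       \sum_(t <- (M `\` (F `|` F'))%fset) w t.
  by apply: ler_sum => t _; apply: le_trans (u'w t); exact: ler_norm.
by rewrite uE in u'0; lra.
Qed.

End UnorderedSums.

Section L2Sums.
Variables (R : realType) (G : groupType) (H : hilbertType R).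
Implicit Types (f h : l2 G H) (u w : G -> R).

Lemma has_sum_rsum u w : (forall t, `|u t| <= w t) ->
  (\esum_(t in [set: G]) (w t)%:E < +oo)%E -> has_sum u (rsum u).
Proof.
move=> uw woo.
have posE : (\esum_(t in [set: G]) ((EFin \o u)^\+ t) =
    \esum_(t in [set: G]) (Num.max (u t) 0)%:E)%E.
  by apply: eq_esum => t _; rewrite funeposE EFin_max.
have negE : (\esum_(t in [set: G]) ((EFin \o u)^\- t) =
    \esum_(t in [set: G]) (Num.max (- u t) 0)%:E)%E.
  by apply: eq_esum => t _; rewrite funenegE EFin_max.
have fin_max (z : G -> R) : (forall t, z t <= w t) ->
    has_sum (fun t => Num.max (z t) 0)
      (fine (\esum_(t in [set: G]) (Num.max (z t) 0)%:E)%E).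
  move=> zw; apply: has_sum_esum => [t|]; first by rewrite le_max lexx orbT.
  apply: le_lt_trans woo; apply: le_esum => t _; rewrite lee_fin.
  by rewrite ge_max zw (le_trans _ (uw t)).
have uE t : u t = Num.max (u t) 0 + -1 * Num.max (- u t) 0.
  by rewrite mulN1r /Num.max; case: ifPn; case: ifPn; lra.
rewrite /rsum posE negE -[X in _ - X]mul1r -mulNr [X in has_sum X _](funext uE).
apply: has_sumD.
  by apply: (fin_max u) => t; rewrite (le_trans (ler_norm _)).
apply: has_sumZ; apply: (fin_max (fun t => - u t)) => t.
by rewrite (le_trans _ (uw t))// -normrN ler_norm.
Qed.

Lemma Re_hdot (v : H) : complex.Re (hdot v v) = hnorm v ^+ 2.
Proof. by rewrite hdot_norm -hnormE -rmorphXn. Qed.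

Lemma Re_hdot_le (v w : H) :
  complex.Re (hdot v w) <= 2^-1 * (hnorm v ^+ 2 + hnorm w ^+ 2).
Proof.
have := hdot_ge0 (v - w); rewrite hdotDl !hdotDr !hdotNl !hdotNr opprK.
rewrite (hdotC w v) lecE => /andP[_]; rewrite !raddfD /= !raddfN /=.
rewrite !Re_hdot; case: (hdot v w) => a b /=; lra.
Qed.

Lemma hnormZ1 (c : R[i]) (v : H) : `|c| = 1 -> hnorm (c *: v) = hnorm v.
Proof. by move=> c1; rewrite /hnorm normrZ c1 mul1r. Qed.

Lemma norm_Re_hdot_le (v w : H) :
  `|complex.Re (hdot v w)| <= 2^-1 * (hnorm v ^+ 2 + hnorm w ^+ 2).
Proof.
rewrite ler_norml Re_hdot_le andbT.
have := Re_hdot_le (- v) w; rewrite hdotNl -[- v]scaleN1r hnormZ1 ?normrN1//.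
case: (hdot v w) => a b /=; lra.
Qed.

(** The imaginary part is a real part after rotating w by i. *)
Lemma norm_Im_hdot_le (v w : H) :
  `|complex.Im (hdot v w)| <= 2^-1 * (hnorm v ^+ 2 + hnorm w ^+ 2).
Proof.
have i1 : `|'i%C : R[i]| = 1.
  by rewrite normc_def /= expr0n add0r expr1n sqrtr1.
have := norm_Re_hdot_le v ('i%C *: w); rewrite hnormZ1//.
rewrite hdotZr.
by case: (hdot v w) => a b /=; rewrite mul0r mulN1r opprK add0r.
Qed.

Lemma has_sum_sq f : has_sum (fun t => hnorm (f t) ^+ 2) (fine (sq_sum f)).
Proof.
by apply: has_sum_esum => [t|]; [exact: sqr_ge0|case: f => f /= /set_mem].
Qed.

Lemma l2_esum f h : (\esum_(t in [set: G])
  (2^-1 * (hnorm (f t) ^+ 2 + hnorm (h t) ^+ 2))%:E < +oo)%E.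
Proof.
have := l2_valP f => /set_mem/= fl; have := l2_valP h => /set_mem/= hl.
apply: (@esum_dom _ _ _ (fun t => hnorm (f t) ^+ 2 + hnorm (h t) ^+ 2) 2^-1).
- by rewrite invr_ge0.
- by move=> t; rewrite addr_ge0// sqr_ge0.
- by [].
- under eq_esum do rewrite EFinD.
  by rewrite esumD; [exact: lte_add_pinfty|..] => t _; rewrite lee_fin sqr_ge0.
Qed.

Lemma has_sum_Re_l2_dot f h : has_sum (fun t => complex.Re (hdot (f t) (h t)))
  (complex.Re (l2_dot f h)).
Proof.
exact: has_sum_rsum (fun t => norm_Re_hdot_le (f t) (h t)) (l2_esum f h).
Qed.

Lemma has_sum_Im_l2_dot f h : has_sum (fun t => complex.Im (hdot (f t) (h t)))
  (complex.Im (l2_dot f h)).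
Proof.
exact: has_sum_rsum (fun t => norm_Im_hdot_le (f t) (h t)) (l2_esum f h).
Qed.

Lemma l2_dot_fin f h (F : {fset G}) : (forall t, t \notin F -> h t = 0) ->
  l2_dot f h = \sum_(t <- F) hdot (f t) (h t).
Proof.
move=> h0; apply/eqP; rewrite eq_complex !raddf_sum /=.
apply/andP; split; apply/eqP.
  by apply: has_sum_unique (has_sum_Re_l2_dot f h) (has_sum_fin _) => t /h0 ->;
    rewrite hdot0r.
by apply: has_sum_unique (has_sum_Im_l2_dot f h) (has_sum_fin _) => t /h0 ->;
  rewrite hdot0r.
Qed.

Lemma delta_subproof (s : G) (v : H) :
  (fun t => if t == s then v else 0) \in @in_l2 R G H.
Proof.
apply/mem_set => /=; rewrite /sq_sum.
have -> : (\esum_(g in [set: G]) (hnorm (if g == s then v else 0) ^+ 2)%:E =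
    \esum_(g in [set s]) (hnorm v ^+ 2)%:E)%E.
  rewrite [RHS]esum_mkcond; apply: eq_esum => t _.
  have [->|ts] := eqVneq t s; first by rewrite mem_set.
  by rewrite memNset ?/hnorm ?normr0 ?expr0n//=; apply/eqP.
by rewrite esum_set1 ?ltry// lee_fin sqr_ge0.
Qed.

Definition delta (s : G) (v : H) : l2 G H := L2 (delta_subproof s v).

End L2Sums.

(** * Positivity of finite sums of a lambda_g *)

Section CrossedSums.
Variables (R : realType) (G : groupType) (S : operatorSystemType R).
Variables (alpha : os_action G S).

Definition coef (L : seq (S * G)) g : S := \sum_(q <- L | q.2 == g) q.1.

(** The section of the matrix sum_g c(g) lambda_g, with n x n matrices c(g), at
    the points p of 'I_n * G. Repetitions in p are harmless and spare the
    bookkeeping of an injective enumeration. *)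
Definition toeplitz_mx n (c : 'I_n -> 'I_n -> G -> S) N (p : 'I_N -> 'I_n * G) :
    'M[S]_N :=
  \matrix_(k, l) alpha (p k).2^-1%g
    (c (p k).1 (p l).1 ((p k).2 * (p l).2^-1)%g).

Variables (E : cstar_envelope S) (act : extended_action alpha E).
Variable pi : faithful_representation (env_alg E).
Local Notation H := (rep_space pi).
Local Notation emb := (env_emb E).
Implicit Types (L : seq (S * G)) (f : G -> H) (xi : l2 G H).

Definition crossed_sum L : l2 G H -> l2 G H :=
  \sum_(q <- L) crossed_op act pi (emb q.1) q.2.

(** The action of crossed_sum L on arbitrary functions, so that it can be
    evaluated on truncations without proving them square summable. *)
Definition crossed_conv L f t : H :=
  \sum_(q <- L) pi (act t^-1%g (emb q.1)) (f (q.2^-1 * t)%g).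

Lemma l2_sumE I (r : seq I) (P : pred I) (F : I -> l2 G H) t :
  (\sum_(i <- r | P i) F i) t = \sum_(i <- r | P i) F i t.
Proof. by elim/big_ind2: _ => // x a y b <- <-. Qed.

Lemma crossed_sumE L xi t : crossed_sum L xi t = crossed_conv L xi t.
Proof. by rewrite /crossed_sum fct_sumE l2_sumE. Qed.

(** On a function supported in M the sum over L becomes a sum over the points of
    M, and the terms of L with the same group element merge into the
    coefficient of L. *)
Lemma crossed_conv_supp L f (M : seq G) t : uniq M ->
  (forall s, s \notin M -> f s = 0) ->
  crossed_conv L f t =
    \sum_(s <- M) pi (emb (alpha t^-1%g (coef L (t * s^-1)%g))) (f s).
Proof.
move=> uM fM.
under [RHS]eq_bigr do rewrite -(ext_actE act) /coef !raddf_sum rep_sum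
  big_mkcond.
rewrite exchange_big; apply: eq_bigr => q _ /=.
rewrite -big_mkcond /=.
have qs s : (q.2 == t * s^-1)%g = (s == q.2^-1 * t)%g.
  apply/eqP/eqP => [->|->]; first by rewrite invgM invgK mulgVK.
  by rewrite invgM invgK mulVKg.
under eq_bigl do rewrite qs.
have [qM|qM] := boolP ((q.2^-1 * t)%g \in M).
  rewrite (big_rem _ qM)/= eqxx big_seq_cond big1 ?addr0// => s.
  by rewrite mem_rem_uniq// !inE => /andP[/andP[/negPf ->]].
rewrite fM// linear0 big_seq_cond big1// => s /andP[sM /eqP sq].
by rewrite -sq sM in qM.
Qed.

Lemma crossed_conv_delta L s v t :
  crossed_conv L (delta s v) t =
    pi (emb (alpha t^-1%g (coef L (t * s^-1)%g))) v.
Proof.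
rewrite (@crossed_conv_supp _ _ [:: s])// => [|r]; last by rewrite inE /= =>
  /negPf ->.
by rewrite big_seq1 /= eqxx.
Qed.

(** The coefficient at g is read off from the value at g of the image of
    delta_1 v. Conversely, the value at t only involves the finitely many points
    q.2^-1 t, where the operator is expressed by its coefficients. *)
Lemma crossed_sum_inj L L' : crossed_sum L = crossed_sum L' <->
  coef L =1 coef L'.
Proof.
have [jinj _] := cover_coe (env_cover E).
split=> [LL' g|LL'].
  have h v : pi (emb (alpha g^-1%g (coef L g))) v =
             pi (emb (alpha g^-1%g (coef L' g))) v.
    by have := crossed_conv_delta L 1%g v g;
      rewrite -crossed_sumE LL' crossed_sumE
      crossed_conv_delta invg1 mulg1.
  apply: (bij_inj (os_act_bij alpha g^-1%g)); apply: jinj; apply/eqP.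
  rewrite -subr_eq0; apply/eqP; apply: (@rep_faithful _ _ pi) => v.
  by rewrite repB h subrr.
apply/funext => xi; apply/val_inj/funext => t; rewrite /= !crossed_sumE.
pose M := undup [seq (q.2^-1 * t)%g | q <- L ++ L'].
have trunc L0 : {subset L0 <= L ++ L'} ->
    crossed_conv L0 xi t = crossed_conv L0 (fun s =>
      if s \in M then xi s else 0) t.
  move=> L0L; rewrite /crossed_conv big_seq [RHS]big_seq; apply: eq_bigr =>
    q /L0L qL.
  by rewrite mem_undup (map_f (fun q : S * G => q.2^-1 * t)%g qL).
rewrite !trunc => [|q|q]; try by rewrite mem_cat => ->; rewrite ?orbT.
rewrite !(@crossed_conv_supp _ _ M) ?undup_uniq//; try by move=> s /negPf ->.
by under eq_bigr do rewrite LL'.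
Qed.

Lemma l2_dot_deltas (h : l2 G H) (I : finType) (P : pred I) (s : I -> G)
    (v : I -> H) :
  l2_dot h (\sum_(k | P k) delta (s k) (v k)) =
    \sum_(k | P k) hdot (h (s k)) (v k).
Proof.
pose F : {fset G} := seq_fset tt [seq s k | k <- enum I].
have sF k : s k \in F by rewrite seq_fsetE map_f// mem_enum.
rewrite (@l2_dot_fin _ _ _ _ _ F) => [|t tF]; last first.
  rewrite l2_sumE big1// => k _ /=; case: eqP => // ts.
  by rewrite ts sF in tF.
under eq_bigr do rewrite l2_sumE hdot_sumr.
rewrite exchange_big; apply: eq_bigr => k _.
rewrite (big_fsetD1 (s k))//= eqxx big_seq big1 ?addr0// => t.
by rewrite !inE => /andP[/negPf -> _]; rewrite hdot0r.
Qed.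

Lemma mx_form_toeplitz n (c : 'I_n -> 'I_n -> G -> S) N (p : 'I_N -> 'I_n * G)
    (v : 'I_N -> H) :
  mx_form (map_mx emb (toeplitz_mx c p)) v v = \sum_k \sum_l
    hdot (pi (emb (alpha (p k).2^-1%g
      (c (p k).1 (p l).1 ((p k).2 * (p l).2^-1)%g))) (v l)) (v k).
Proof. by apply: eq_bigr => k _; apply: eq_bigr => l _; rewrite !mxE. Qed.

Definition crossed_form n (L : 'I_n -> 'I_n -> seq (S * G))
    (xi : 'I_n -> l2 G H) :=
  \sum_i \sum_j l2_dot (crossed_sum (L i j) (xi j)) (xi i).

(** Test the form on the vectors xi_j, sums of the point masses v_l at t_l over
    those l for which p l = (j, t_l). *)
Lemma crossed_form_ge0_toeplitz n (L : 'I_n -> 'I_n -> seq (S * G)) :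
  (forall xi : 'I_n -> l2 G H, 0 <= crossed_form L xi) ->
  forall N (p : 'I_N -> 'I_n * G),
    os_pos S N (toeplitz_mx (fun i j => coef (L i j)) p).
Proof.
move=> L0 N p; apply/(os_pos_rep pi) => v.
pose xi j := \sum_(l | (p l).1 == j) delta (p l).2 (v l).
have := L0 xi; rewrite /crossed_form mx_form_toeplitz.
under eq_bigr do under eq_bigr do rewrite l2_dot_deltas.
under eq_bigr do rewrite exchange_big.
rewrite (partition_big (fun k => (p k).1) xpredT)//=.
congr (0 <= _); apply: eq_bigr => i _; apply: eq_bigr => k /eqP ki.
rewrite [RHS](partition_big (fun l => (p l).1) xpredT)//=.
apply: eq_bigr => j _; rewrite crossed_sumE -hdot_suml; congr (hdot _ _).
have -> : crossed_conv (L i j) (xi j) (p k).2 =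
    \sum_(l | (p l).1 == j) crossed_conv (L i j) (delta (p l).2 (v l)) (p k).2.
  rewrite /crossed_conv exchange_big; apply: eq_bigr => q _ /=.
  by rewrite /xi l2_sumE linear_sum.
by apply: eq_bigr => l /eqP lj; rewrite crossed_conv_delta ki lj.
Qed.

(** One real component rho of the form at a time: the statement is used for the
    real part, the imaginary part and its opposite. Truncating xi to a finite
    set M gives the form of a section, and if M contains g^-1 F for each group
    element g that occurs in L, then the truncation is exact at the points
    of F. *)
Lemma crossed_form_part_ge0 (rho : R[i] -> R) n
    (L : 'I_n -> 'I_n -> seq (S * G)) (xi : 'I_n -> l2 G H) :
  {morph rho : x y / x + y} ->
  (forall z, 0 <= z -> 0 <= rho z) ->
  (forall v w : H, `|rho (hdot v w)| <= 2^-1 * (hnorm v ^+ 2 + hnorm w ^+ 2)) ->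
  (forall f h : l2 G H, has_sum (fun t =>
    rho (hdot (f t) (h t))) (rho (l2_dot f h))) ->
  (forall N (p : 'I_N -> 'I_n * G),
    os_pos S N (toeplitz_mx (fun i j => coef (L i j)) p)) ->
  0 <= rho (crossed_form L xi).
Proof.
move=> rhoD rho_ge0 rho_hdot rho_l2 Lpos.
have rho0 : rho 0 = 0 by apply: (addrI (rho 0)); rewrite -rhoD !addr0.
have rho_sum I (r : seq I) (P : pred I) (F : I -> R[i]) :
    rho (\sum_(i <- r | P i) F i) = \sum_(i <- r | P i) rho (F i).
  exact: (big_morph rho rhoD rho0).
(* This majorant covers every truncation, and is summable because each
   crossed_op maps l^2(G, H) to itself. *)
pose w t := \sum_i \sum_j \sum_(q <- L i j)
  2^-1 * (hnorm (crossed_op act pi (emb q.1) q.2 (xi j) t) ^+ 2 + hnorm (xi i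
    t) ^+ 2).
pose u t := \sum_i \sum_j rho (hdot (crossed_sum (L i j) (xi j) t) (xi i t)).
have hu : has_sum u (rho (crossed_form L xi)).
  rewrite rho_sum; under eq_bigr do rewrite rho_sum.
  by do 2!apply: has_sum_sum => ?; exact: rho_l2.
have [W hw] : exists W, has_sum w W.
  eexists; do 3!apply: has_sum_sum => ?.
  by apply: has_sumZ; apply: has_sumD; exact: has_sum_sq.
apply: (has_sum_ge0 hu hw) => F.
pose K := [seq (q.2^-1 * t)%g | t <- F,
  q <- flatten [seq L ij.1 ij.2 | ij <- enum {: 'I_n * 'I_n}]].
pose M : {fset G} := (F `|` seq_fset tt K)%fset.
have KM i j q t : q \in L i j -> t \in F -> (q.2^-1 * t)%g \in M.
  move=> qL tF; rewrite !inE seq_fsetE; apply/orP; right.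
  apply/allpairsP; exists (t, q); split=> //=; apply/flattenP.
  by exists (L i j) => //; apply/mapP; exists (i, j) => //; rewrite mem_enum.
exists M; first exact: fsubsetUl.
pose eta j s := if s \in M then xi j s else 0.
exists (fun t => \sum_i \sum_j rho (hdot (crossed_conv (L i j) (eta j) t) (xi i
  t))).
  split=> [t|t tF].
    rewrite (le_trans (ler_norm_sum _ _ _))// ler_sum// => i _.
    rewrite (le_trans (ler_norm_sum _ _ _))// ler_sum// => j _.
    rewrite hdot_suml rho_sum (le_trans (ler_norm_sum _ _ _))// ler_sum// =>
      q _.
    rewrite /eta; case: ifP => _; first exact: rho_hdot.
    by rewrite linear0 hdot0l rho0 normr0 mulr_ge0// addr_ge0 ?sqr_ge0.
  apply: eq_bigr => i _; apply: eq_bigr => j _; rewrite crossed_sumE.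
  congr (rho (hdot _ _)); rewrite /crossed_conv big_seq [RHS]big_seq.
  by apply: eq_bigr => q qL; rewrite /eta (KM i j).
pose P := [seq (i, t) | i <- enum 'I_n, t <- (M : seq G)].
have := Lpos _ (tnth (in_tuple P)); move/(os_pos_rep pi).
move/(_ (fun k => let x := tnth (in_tuple P) k in xi x.1 x.2)) => /rho_ge0.
rewrite mx_form_toeplitz.
pose Phi x y := hdot (pi (emb (alpha x.2^-1%g
  (coef (L x.1 y.1) (x.2 * y.2^-1)%g))) (xi y.1 y.2)) (xi x.1 x.2).
rewrite (_ : \sum_k _ = \sum_(x <- P) \sum_(y <- P) Phi x y); last first.
  by rewrite [RHS]big_tnth; apply: eq_bigr => k _; rewrite [RHS]big_tnth.
congr (0 <= _); rewrite rho_sum big_allpairs big_enum exchange_big /=.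
apply: eq_bigr => t _; apply: eq_bigr => i _.
rewrite big_allpairs big_enum rho_sum /=; apply: eq_bigr => j _.
rewrite (@crossed_conv_supp _ _ M) ?fset_uniq// => [|s /negPf]; last first.
  by rewrite /eta => ->.
rewrite hdot_suml big_seq [in RHS]big_seq; congr (rho _).
by apply: eq_bigr => s sM; rewrite /eta sM.
Qed.

Lemma crossed_form_ge0P n (L : 'I_n -> 'I_n -> seq (S * G)) :
  (forall xi : 'I_n -> l2 G H, 0 <= crossed_form L xi) <->
  forall N (p : 'I_N -> 'I_n * G),
    os_pos S N (toeplitz_mx (fun i j => coef (L i j)) p).
Proof.
split=> [|Lpos xi]; first exact: crossed_form_ge0_toeplitz.
have Re0 : 0 <= complex.Re (crossed_form L xi).
  apply: crossed_form_part_ge0 Lpos.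
  - exact: raddfD.
  - by move=> z; rewrite lecE => /andP[].
  - exact: norm_Re_hdot_le.
  - exact: has_sum_Re_l2_dot.
have Im0 : 0 <= complex.Im (crossed_form L xi).
  apply: crossed_form_part_ge0 Lpos.
  - exact: raddfD.
  - by move=> z /ger0_Im ->.
  - exact: norm_Im_hdot_le.
  - exact: has_sum_Im_l2_dot.
have NIm0 : 0 <= - complex.Im (crossed_form L xi).
  apply: (crossed_form_part_ge0 (rho := fun z => - complex.Im z)) Lpos.
  - by move=> x y /=; rewrite raddfD opprD.
  - by move=> z /ger0_Im ->; rewrite oppr0.
  - by move=> v w; rewrite normrN; exact: norm_Im_hdot_le.
  - move=> f h; rewrite -mulN1r;
    under [X in has_sum X]funext do rewrite -mulN1r.
    by apply: has_sumZ; exact: has_sum_Im_l2_dot.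
rewrite lecE Re0 andbT; apply/eqP/le_anti.
by rewrite Im0 -oppr_ge0 NIm0.
Qed.

End CrossedSums.
Arguments crossed_sum {R G S alpha E} act pi L _.

(** * Elements of the crossed product as finite sums *)

Section Presentations.
Variables (R : realType) (G : groupType) (S : operatorSystemType R).
Variables (alpha : os_action G S) (E : cstar_envelope S).
Variables (act : extended_action alpha E).
Variables (pi : faithful_representation (env_alg E)) (gens : set G).
Implicit Types (L : seq (S * G)) (x : os_crossed act pi gens).

(** L is one of the many ways to write x as a sum of s lambda_g with g in gens;
    all choices made below are compared through their coefficients. *)
Definition presents L x :=
  (forall q, q \in L -> gens q.2) /\ span_val x = crossed_sum act pi L.

Lemma crossed_opZ c s g : crossed_op act pi (env_emb E (c *: s)) g =
  c *: crossed_op act pi (env_emb E s) g.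
Proof.
apply/funext => xi; apply/val_inj/funext => t /=.
by rewrite !linearZ_LR repZ.
Qed.

Lemma presents_ex x : exists L, presents L x.
Proof.
have /set_mem[n [c [T [opT xE]]]] := span_valP x.
have /choice[q qT] : forall i, exists q : S * G,
    gens q.2 /\ T i = crossed_op act pi (env_emb E q.1) q.2.
  by move=> i; have [s [g [? ?]]] := opT i; exists (s, g).
exists [seq (c i *: (q i).1, (q i).2) | i <- enum 'I_n]; split=> [r|].
  by case/mapP => i _ ->; exact: (qT i).1.
rewrite xE /crossed_sum big_map big_enum; apply: eq_bigr => i _ /=.
by rewrite crossed_opZ (qT i).2.
Qed.

Lemma ex_presents L : (forall q, q \in L -> gens q.2) ->
  exists x, presents L x.
Proof.
move=> gL; have spanL : crossed_sum act pi L \in in_lspan (@os_crossed_ops _ _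
  _ _ _ act pi gens).
  rewrite /crossed_sum big_seq; apply: rpred_sum => q /gL gq.
  by apply: lspan_gen; exists q.1, q.2.
by exists (SpanType spanL).
Qed.

Lemma presents_elt s g (hg : gens g) :
  presents [:: (s, g)] (os_crossed_elt act pi s hg).
Proof.
split=> [q|]; first by rewrite inE => /eqP ->.
by rewrite /crossed_sum big_seq1.
Qed.

Lemma presentsP c L L' x x' : presents L x -> presents L' x' ->
  presents ([seq (c *: q.1, q.2) | q <- L] ++ L') (c *: x + x').
Proof.
move=> [gL xL] [gL' xL']; split=> [q|].
  by rewrite mem_cat => /orP[/mapP[r /gL ? ->]|/gL'].
rewrite /crossed_sum big_cat big_map /=.
under eq_bigr do rewrite crossed_opZ.
by rewrite -scaler_sumr; congr (_ *: _ + _).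
Qed.

Lemma presents_inj L L' x x' : presents L x -> presents L' x' ->
  x = x' <-> coef L =1 coef L'.
Proof.
move=> [_ xL] [_ xL']; rewrite -(crossed_sum_inj act pi) -xL -xL'.
by split=> [->|/val_inj].
Qed.

Lemma presents_pos n (L : 'I_n -> 'I_n -> seq (S * G))
    (X : 'M[os_crossed act pi gens]_n) :
  (forall i j, presents (L i j) (X i j)) ->
  os_crossed_pos act pi gens n X <->
  forall N (p : 'I_N -> 'I_n * G),
    os_pos S N (toeplitz_mx alpha (fun i j => coef (L i j)) p).
Proof.
move=> LX; rewrite -(crossed_form_ge0P act pi).
have LXE xi : crossed_form act L xi =
    \sum_i \sum_j l2_dot (span_val (X i j) (xi j)) (xi i).
  by apply: eq_bigr => i _; apply: eq_bigr => j _; rewrite (LX i j).2.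
by split=> h xi; have := h xi; rewrite LXE.
Qed.

End Presentations.

Section Functoriality.
Variables (R : realType) (G : groupType) (S T : operatorSystemType R).
Variable phi : {linear S -> T}.
Implicit Types (L : seq (S * G)).

Definition map_coef L : seq (T * G) := [seq (phi q.1, q.2) | q <- L].

Lemma coef_map L g : coef (map_coef L) g = phi (coef L g).
Proof. by rewrite /coef big_map raddf_sum. Qed.

Lemma toeplitz_mx_map (alpha : os_action G S) (beta : os_action G T) n
    (L : 'I_n -> 'I_n -> seq (S * G)) N (p : 'I_N -> 'I_n * G) :
  (forall g s, beta g (phi s) = phi (alpha g s)) ->
  toeplitz_mx beta (fun i j => coef (map_coef (L i j))) p =
  map_mx phi (toeplitz_mx alpha (fun i j => coef (L i j)) p).
Proof.
by move=> phiE; apply/matrixP => k l; rewrite !mxE coef_map phiE.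
Qed.

End Functoriality.

Theorem proposition3p25 (R : realType) (G : groupType) (gens : set G)
    (hgens : symmetric_generating_set gens)
    (S T : operatorSystemType R)
    (alpha : os_action G S) (beta : os_action G T)
    (ES : cstar_envelope S) (ET : cstar_envelope T)
    (alphaE : extended_action alpha ES) (betaE : extended_action beta ET)
    (piS : faithful_representation (env_alg ES))
    (piT : faithful_representation (env_alg ET))
    (phi : {linear S -> T}) (phi_ucp : os_ucp phi)
    (phi_equivariant : forall g s, beta g (phi s) = phi (alpha g s)) :
  exists phit : {linear os_crossed alphaE piS gens -> os_crossed betaE piT gens},
    [/\ forall s g (hg : gens g),
          phit (os_crossed_elt alphaE piS s hg) =
          os_crossed_elt betaE piT (phi s) hg,
        forall psi : {linear os_crossed alphaE piS gens ->
                              os_crossed betaE piT gens},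
          (forall s g (hg : gens g),
             psi (os_crossed_elt alphaE piS s hg) =
             os_crossed_elt betaE piT (phi s) hg) ->
          psi =1 phit,
        ucp (os_crossed_unit alphaE piS (gens_one hgens))
          (os_crossed_pos alphaE piS gens)
          (os_crossed_unit betaE piT (gens_one hgens))
          (os_crossed_pos betaE piT gens) phit &
        complete_order_embedding (os_pos S) (os_pos T) phi ->
        complete_order_embedding (os_crossed_pos alphaE piS gens)
          (os_crossed_pos betaE piT gens) phit].
Proof.
have map_presented (x : os_crossed alphaE piS gens) :
    exists y : os_crossed betaE piT gens,
    exists2 L, presents L x & presents (map_coef phi L) y.
  have [L Lx] := presents_ex x.
  have [q|y Ly] := @ex_presents _ _ _ _ _ betaE piT gens (map_coef phi L).
    by case/mapP => r /Lx.1 ? ->.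
  by exists y, L.
(* f is defined from one presentation of each x; comparing coefficients shows
   that every other presentation gives the same value. *)
have [f fL] := choice map_presented.
have fE x L : presents L x -> presents (map_coef phi L) (f x).
  move=> Lx; have [L' L'x L'fx] := fL x.
  have [|y Ly] := @ex_presents _ _ _ _ _ betaE piT gens (map_coef phi L).
    by move=> q /mapP[r /Lx.1 ? ->].
  suff -> : f x = y by [].
  apply/(presents_inj L'fx Ly) => g; rewrite !coef_map.
  by rewrite (iffLR (presents_inj L'x Lx) erefl).
have f_lin : linear f.
  move=> c x y; have [[L Lx _] [M My _]] := (fL x, fL y).
  apply/(presents_inj (fE _ _ (presentsP c Lx My)) (presentsP c (fE _ _ Lx) (fE
    _ _ My))).
  move=> g; congr (coef _ g); rewrite /map_coef map_cat; congr (_ ++ _).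
  by rewrite -!map_comp; apply: eq_map => q /=; rewrite linearZ_LR.
pose phit : {linear os_crossed alphaE piS gens -> os_crossed betaE piT gens} :=
  HB.pack f (GRing.isLinear.Build _ _ _ _ f f_lin).
have phit_elt s g (hg : gens g) : phit (os_crossed_elt alphaE piS s hg) =
    os_crossed_elt betaE piT (phi s) hg.
  apply/(presents_inj (fE _ _ (presents_elt alphaE piS s hg))
                      (presents_elt betaE piT (phi s) hg)).
  by [].
have pos_coef n (X : 'M[os_crossed alphaE piS gens]_n) :
    exists2 L, (os_crossed_pos alphaE piS gens n X <->
      forall N (p : 'I_N -> 'I_n * G),
        os_pos S N (toeplitz_mx alpha (fun i j => coef (L i j)) p)) &
      (os_crossed_pos betaE piT gens n (map_mx phit X) <->
      forall N (p : 'I_N -> 'I_n * G),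
        os_pos T N (map_mx phi (toeplitz_mx alpha (fun i j =>
          coef (L i j)) p))).
  have /choice[L LX] : forall ij, exists L, presents L (X ij.1 ij.2).
    by move=> ij; exact: presents_ex.
  exists (fun i j => L (i, j)).
    by apply: presents_pos => i j; exact: (LX (i, j)).
  rewrite (presents_pos (L := fun i j => map_coef phi (L (i, j)))) => [|i j].
    by split=> h N p; have := h N p;
      rewrite (toeplitz_mx_map _ _ phi_equivariant).
  by rewrite mxE; apply: fE; exact: (LX (i, j)).
exists phit; split.
- exact: phit_elt.
- move=> psi psi_elt x.
  have [n [c [t [opt xE]]]] := set_mem (span_valP x).
  have -> : x = \sum_i c i *: span_gen (opt i).
    apply/val_inj; rewrite /= xE.
    by rewrite (big_morph (@span_val _ _ _) (fun _ _ => erefl) erefl).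
  rewrite !linear_sum; apply: eq_bigr => i _; rewrite !linearZ_LR;
    congr (_ *: _).
  have [s [g [hg tE]]] := opt i.
  have -> : span_gen (opt i) = os_crossed_elt alphaE piS s hg.
    by apply/val_inj; rewrite /= tE.
  by rewrite psi_elt phit_elt.
- split; first by rewrite /os_crossed_unit phit_elt phi_ucp.1.
  move=> n X; have [L XL fXL] := pos_coef n X.
  by move/XL => h; apply/fXL => N p; apply: phi_ucp.2.
- move=> [phi_inj phi_coe]; split=> [x y xy|n X]; last first.
    have [L XL fXL] := pos_coef n X; rewrite XL fXL.
    by split=> h N p; apply/phi_coe.
  have [[L Lx _] [M My _]] := (fL x, fL y).
  apply/(presents_inj Lx My) => g; apply: phi_inj; rewrite -!coef_map.
  by have /(presents_inj (fE _ _ Lx) (fE _ _ My)) -> := xy.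
Qed.
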